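(* Let $k$ be an algebraically closed field, let $n\ge 3$, and let $(x,y)\in \mathbf{F}$ with $x<n$, where $\mathbf{F}=\{(x,y)\mid \frac{2}{n}x\le y\le x\}$ (pairs of positive integers). Let $\mathcal{M}(x,y)$ be the set of elementary modules of $\mathcal{K}_{x+y-1}$ with dimension vector $(x,y)$, and let $\mathcal{L}(x,y)$ be the set of maximum linear subspaces $\mathcal{H}\subseteq L(V^{y},V^{x+y-1})$ such that $\operatorname{rk} v=y$ for all $0\neq v\in\mathcal{H}$. Then there exists a bijection between $\mathcal{M}(x,y)$ and $\mathcal{L}(x,y)$ up to isomorphism, i.e. between the set of isomorphism classes of modules in $\mathcal{M}(x,y)$ and the set of isomorphism classes of subspaces in $\mathcal{L}(x,y)$.
   Context: For an integer $r\ge 1$, the $r$-Kronecker quiver $K(r)$ has two vertices $1,2$ and $r$ arrows $\gamma_1,\dots,\gamma_r:1\to 2$; $\mathcal{K}_r=kK(r)$ is its path algebra. Finite-dimensional $\mathcal{K}_r$-modules are identified with finite-dimensional representations $M=(M_1,M_2,(M(\gamma_i))_{1\le i\le r})$, where $M_1,M_2$ are finite-dimensional $k$-vector spaces and $M(\gamma_i):M_1\to M_2$ are $k$-linear. The dimension vector of $M$ is $(\dim_k M_1,\dim_k M_2)$. An indecomposable module $M$ is regular if $\tau^t M\neq 0$ for all $t\in\mathbb{Z}$, where $\tau$ is the Auslander--Reiten translation (equivalently, $M$ is neither preprojective nor preinjective); a module is called regular if all its indecomposable direct summands are regular. A nonzero regular module $M$ is elementary if there is no short exact sequence $0\to L\to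 M\to N\to 0$ with $L,N$ nonzero regular modules. $V^i$ denotes the $i$-dimensional $k$-vector space, $L(V^j,V^i)$ the space of all $k$-linear maps $V^j\to V^i$, and $\operatorname{rk} v$ the rank of $v$. A ''maximum'' linear subspace with the stated rank property is one whose dimension is largest among all linear subspaces of $L(V^{y},V^{x+y-1})$ all of whose nonzero elements have rank $y$. Two subspaces $\mathcal{H},\mathcal{H}'\in\mathcal{L}(x,y)$ are called isomorphic if there is $g\in GL(V^{y})$ with $\mathcal{H}'=\{v\circ g\mid v\in\mathcal{H}\}$. Isomorphism of modules is the usual isomorphism of representations.
   Formalization: The formal theorem additionally assumes y ≥ 2; for y = 1 the claim is false, since no module of K_x with dimension vector (x,1) is regular, so M(x,1) is empty, while L(x,1) contains the whole space L(V^1,V^x) (e.g. n = 3, x = y = 1). *)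

(* Defs.v *)
From HB Require Import structures.
From mathcomp Require Import all_boot all_order all_algebra.

Set Implicit Arguments.
Unset Strict Implicit.
Unset Printing Implicit Defensive.

Import Order.TTheory GRing.Theory Num.Theory.
Local Open Scope ring_scope.

(* Finite-dimensional modules over the path algebra of the r-Kronecker quiver,
   viewed as representations; gam j is the map of the j-th arrow 1 -> 2. *)
Record krep (k : fieldType) (r : nat) := KRep {
  rep1 : vectType k;
  rep2 : vectType k;
  gam : 'I_r -> 'Hom(rep1, rep2)
}.

Record khom (k : fieldType) (r : nat) (M N : krep k r) := KHom {
  hom1 : 'Hom(rep1 M, rep1 N);
  hom2 : 'Hom(rep2 M, rep2 N);
  khom_comm : forall j, (hom2 \o gam M j = gam N j \o hom1)%VF
}.

Section Representations.
Variables (k : fieldType) (r : nat).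
Implicit Types M N X Y : krep k r.

Definition has_dimvec M (x y : nat) : Prop :=
  \dim (fullv : {vspace rep1 M}) = x /\ \dim (fullv : {vspace rep2 M}) = y.

Definition rep_zero M : Prop := has_dimvec M 0 0.

Definition rep_inj M N (f : khom M N) : Prop :=
  lker (hom1 f) = 0%VS /\ lker (hom2 f) = 0%VS.

Definition rep_surj M N (f : khom M N) : Prop :=
  limg (hom1 f) = fullv /\ limg (hom2 f) = fullv.

Definition rep_exact L M N (f : khom L M) (g : khom M N) : Prop :=
  limg (hom1 f) = lker (hom1 g) /\ limg (hom2 f) = lker (hom2 g).

Definition rep_iso M N : Prop :=
  exists f : khom M N, rep_inj f /\ rep_surj f.

Definition short_exact L M N : Prop :=
  exists (f : khom L M) (g : khom M N),
    [/\ rep_inj f, rep_exact f g & rep_surj g].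

Definition rep_sum M N : krep k r :=
  @KRep k r (rep1 M * rep1 N)%type (rep2 M * rep2 N)%type
    (fun j => linfun (fun m => (gam M j m.1, gam N j m.2))).

Definition indecomposable M : Prop :=
  ~ rep_zero M /\
  forall X Y, rep_iso M (rep_sum X Y) -> rep_zero X \/ rep_zero Y.

Definition direct_summand X M : Prop :=
  exists Y, rep_iso M (rep_sum X Y).

(* The indecomposable projectives P(1) = (k, k^r) and P(2) = (0, k), and the
   map P(2) -> P(1) on the vertex 2 spaces given by the j-th arrow. *)
Definition proj1_emb (j : 'I_r) : 'Hom(k^o, 'rV[k]_r) :=
  linfun (fun c : k^o => c *: delta_mx 0 j).

Definition proj1 : krep k r := @KRep k r k^o 'rV[k]_r proj1_emb.
Definition proj2 : krep k r := @KRep k r 'rV[k]_0 k^o (fun=> 0).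

(* The standard projective resolution
     0 -> P(2) (x) k^r (x) M_1 -> P(1) (x) M_1 (+) P(2) (x) M_2 -> M -> 0
   turns Hom(-, N) into the two-term complex
     Hom(M_1, N_1) (+) Hom(M_2, N_2) -> (+)_j Hom(M_1, N_2)
   whose cokernel is Ext^1(M, N).  The dual D Ext^1(M, N) is thus the space of
   linear forms on the target which vanish on the image of ext_diff. *)
Definition ext_target M N : vectType k := {ffun 'I_r -> 'Hom(rep1 M, rep2 N)}.

Definition ext_diff M N :
    'Hom(('Hom(rep1 M, rep1 N) * 'Hom(rep2 M, rep2 N))%type, ext_target M N) :=
  linfun (fun u : 'Hom(rep1 M, rep1 N) * 'Hom(rep2 M, rep2 N) =>
            [ffun j => (u.2 \o gam M j)%VF - (gam N j \o u.1)%VF]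
              : ext_target M N).

Definition DExt1 M N : {vspace 'Hom(ext_target M N, k^o)} :=
  lker (linfun (fun phi : 'Hom(ext_target M N, k^o) =>
                  (phi \o ext_diff M N)%VF)).

(* Functoriality: proj1_emb j : P(2) -> P(1) induces
   Ext^1(M, P(2)) -> Ext^1(M, P(1)). *)
Definition ext_push M (j : 'I_r) : 'Hom(ext_target M proj2, ext_target M proj1) :=
  linfun (fun t : ext_target M proj2 =>
            [ffun i => (proj1_emb j \o (t i : 'Hom(rep1 M, k^o)))%VF]
              : ext_target M proj1).

(* The Auslander-Reiten translation tau = D Tr = D Ext^1(-, A), where
   A = P(1) (+) P(2) is the (hereditary) path algebra. *)
Definition tau M : krep k r :=
  @KRep k r (subvs_of (DExt1 M proj1)) (subvs_of (DExt1 M proj2))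
    (fun j => linfun (fun phi : subvs_of (DExt1 M proj1) =>
                vsproj (DExt1 M proj2) (vsval phi \o ext_push M j)%VF)).

(* The k-duality D; the opposite of the Kronecker quiver is again the Kronecker
   quiver, with the two vertices exchanged. *)
Definition dual_rep M : krep k r :=
  @KRep k r 'Hom(rep2 M, k^o) 'Hom(rep1 M, k^o)
    (fun j => linfun (fun phi : 'Hom(rep2 M, k^o) => (phi \o gam M j)%VF)).

(* tau^- = Tr D = D (D Tr) D. *)
Definition tauV M : krep k r := dual_rep (tau (dual_rep M)).

Definition tau_pow (t : int) M : krep k r :=
  match t with
  | Posz n => iter n tau M
  | Negz n => iter n.+1 tauV M
  end.

Definition regular_indec X : Prop :=
  indecomposable X /\ forall t : int, ~ rep_zero (tau_pow t X).

Definition regular M : Prop :=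
  forall X, indecomposable X -> direct_summand X M -> regular_indec X.

Definition elementary M : Prop :=
  [/\ ~ rep_zero M, regular M &
    ~ exists L N, [/\ ~ rep_zero L, regular L, ~ rep_zero N, regular N
                    & short_exact L M N]].

End Representations.

(* The space L(V^j, V^i). *)
Notation lin_maps k j i := 'Hom('rV[k]_j, 'rV[k]_i).

Definition lin_rank (k : fieldType) (j i : nat) (v : lin_maps k j i) : nat :=
  \dim (limg v).

Definition rank_property (k : fieldType) (j i : nat)
    (H : {vspace lin_maps k j i}) : Prop :=
  forall v, v \in H -> v != 0 -> lin_rank v = j.

Definition subspace_iso (k : fieldType) (j i : nat)
    (H H' : {vspace lin_maps k j i}) : Prop :=
  exists2 g : 'End('rV[k]_j), lker g = 0%VS &
    forall w, w \in H' <-> exists2 v, v \in H & w = (v \o g)%VF.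

Definition setM (k : fieldType) (x y : nat) (M : krep k (x + y - 1)) : Prop :=
  elementary M /\ has_dimvec M x y.

Definition setL (k : fieldType) (x y : nat)
    (H : {vspace lin_maps k y (x + y - 1)}) : Prop :=
  rank_property H /\
  forall H' : {vspace lin_maps k y (x + y - 1)},
    rank_property H' -> (\dim H' <= \dim H)%N.

(* The set of equivalence classes of the elements of A under R. *)
Definition classes (T : Type) (R : T -> T -> Prop) (A : T -> Prop) : Type :=
  {C : T -> Prop | exists2 a, A a & C = (fun b => A b /\ R a b)}.

Definition setF (n x y : nat) : Prop :=
  [/\ (0 < x)%N, (0 < y)%N,
     2%:R / n%:R * x%:R <= y%:R :> rat & (y <= x)%N].

(* Main.v *)
Require Import Defs.
From HB Require Import structures.
From mathcomp Require Import all_boot all_order all_algebra.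
From mathcomp Require Import boolp zify.

(* Put r = x + y - 1.  A module M with dimension vector (x, y) is elementary
   iff every nonzero m in M_1 generates M_2.  Since x, y <= r - 1, the Coxeter
   transformation preserves the slope condition "a > 0 and b <= (r - 1) a", so a
   module of dimension at most (r - 1, r - 1) is regular iff its arrows have no
   common kernel and jointly span M_2.  If m spans U != M_2 under the arrows, then
   L = ({m' | gam_j m' in U for all j}, U) and M / L are regular; conversely, if
   every m generates M_2, a submodule with L_1 != 0 has L_2 = M_2.

   Choosing coordinates on M_2 turns such an M into the x-dimensional space of
   maps k^y -> k^r, w |-> (w . gam_j m)_j, for m in M_1, all of whose nonzero
   members are injective.  The maximal dimension of such a space is x: Toeplitz
   matrices (polynomial multiplication) attain it, and it cannot be exceeded as
   r <= a + b bilinear forms on k^(a+1) x k^(b+1) have a common zero (u, v) with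
   u, v != 0.  The latter is proved by counting dimensions in the graded dual of
   the Segre ring: the functionals killed by r linear forms survive in every
   degree, and an eigenvalue argument then produces a point. *)

Set Implicit Arguments.
Unset Strict Implicit.
Unset Printing Implicit Defensive.
Import GRing.Theory.

(** * Eigenvectors of pencils and points of inverse systems *)

Section Pencil.
Local Open Scope ring_scope.

(** As q maps W into p(W), it factors on W as p after some endomorphism of W; an eigenvector of that
    endomorphism, which exists over an algebraically closed field, is the required w. *)
Lemma pencil_eigenvector (k : closedFieldType) (U V : vectType k)
    (p q : 'Hom(U, V)) (W : {vspace U}) :
  W != 0%VS -> (q @: W <= p @: W)%VS ->
  exists t w, [/\ w \in W, w != 0 & q w = t *: p w].
Proof.
move=> W0 qp; set m := \dim W; set e := vbasis W.
have m0 : (0 < m)%N by rewrite lt0n dimv_eq0.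
have eW i : e`_i \in W.
  case: (ltnP i (size e)) => hi; first by rewrite (vbasis_mem (mem_nth 0 hi)).
  by rewrite nth_default // mem0v.
have: forall i : 'I_m, exists x : 'rV[k]_m, q e`_i = p (\sum_j x 0 j *: e`_j).
  move=> i; have /(subvP qp)/memv_imgP[w wW ->] : q e`_i \in (q @: W)%VS.
    exact: memv_img.
  exists (\row_j coord e j w); congr (p _); rewrite {1}(coord_vbasis wW).
  by apply: eq_bigr => j _; rewrite mxE.
move=> /choice[A hA]; pose B := \matrix_i A i.
have [t] : exists t, root (char_poly B) t.
  by apply/closed_rootP; rewrite size_char_poly eqSS -lt0n.
rewrite -eigenvalue_root_char => /eigenvalueP[x hx x0].
exists t, (\sum_i x 0 i *: e`_i); split.
- by apply: memv_suml => i _; rewrite memvZ.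
- apply: contra x0 => /eqP h; apply/eqP/rowP => i; rewrite mxE.
  by move/freeP: (basis_free (vbasisP W)) => /(_ (fun j => x 0 j)); apply.
transitivity (p (\sum_j (x *m B) 0 j *: e`_j)); last first.
  rewrite hx -linearZ; congr (p _); rewrite scaler_sumr.
  by apply: eq_bigr => i _; rewrite mxE scalerA.
rewrite linear_sum /=.
under eq_bigr do rewrite linearZ /= hA -linearZ.
rewrite -linear_sum /=; congr (p _).
under eq_bigr do rewrite scaler_sumr.
rewrite exchange_big; apply: eq_bigr => j _ /=.
rewrite mxE scaler_suml; apply: eq_bigr => i _.
by rewrite scalerA mxE.
Qed.

End Pencil.

(* W d plays the part of the dual of the degree d component of a commutative
   graded algebra generated in degree 1 by the X i, which act by contraction. *)
Section InverseSystem.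
Local Open Scope ring_scope.
Variables (k : closedFieldType) (I : finType) (V : nat -> vectType k).
Variable X : forall d, I -> 'Hom(V d.+1, V d).
Hypothesis Xcomm : forall d i j w, X d i (X d.+1 j w) = X d j (X d.+1 i w).
Hypothesis Xfaithful : forall d w, (forall i, X d i w = 0) -> w = 0.

Definition lform d (c : {ffun I -> k^o}) : 'Hom(V d.+1, V d) :=
  \sum_i c i *: X d i.

Lemma lformE d c w : lform d c w = \sum_i c i *: X d i w.
Proof. by rewrite sum_lfunE; apply: eq_bigr => i _; rewrite scale_lfunE. Qed.

Lemma lformD d c c' w : lform d (c + c') w = lform d c w + lform d c' w.
Proof.
rewrite !lformE -big_split; apply: eq_bigr => i _ /=.
by rewrite ffunE scalerDl.
Qed.

Lemma lformZ d t c w : lform d (t *: c) w = t *: lform d c w.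
Proof.
rewrite !lformE scaler_sumr; apply: eq_bigr => i _.
by rewrite ffunE scalerA.
Qed.

Definition dform (i : I) : {ffun I -> k^o} := [ffun j => (j == i)%:R].

Lemma lform_dform d i w : lform d (dform i) w = X d i w.
Proof.
rewrite lformE (bigD1 i) //= big1 ?addr0 => [|j /negPf ji].
  by rewrite ffunE eqxx scale1r.
by rewrite ffunE ji scale0r.
Qed.

Lemma lform_comm d c c' w :
  lform d c (lform d.+1 c' w) = lform d c' (lform d.+1 c w).
Proof.
rewrite !lformE; under eq_bigr do rewrite linear_sum scaler_sumr.
rewrite exchange_big; apply: eq_bigr => i _ /=.
rewrite linear_sum scaler_sumr; apply: eq_bigr => j _ /=.
by rewrite !linearZ /= Xcomm !scalerA mulrC.
Qed.

Variable W : forall d, {vspace V d}.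
Hypothesis XW : forall d i w, w \in W d.+1 -> X d i w \in W d.
Hypothesis W0 : forall d, W d != 0%VS.

Lemma lformW d c w : w \in W d.+1 -> lform d c w \in W d.
Proof.
by move=> hw; rewrite lformE; apply: memv_suml => i _; rewrite memvZ ?XW.
Qed.

(** Dual of the degree d + 1 component of the quotient by the linear forms in A; the index d is one
    below the degree. *)
Definition cutspace (A : {vspace {ffun I -> k^o}}) d : {vspace V d.+1} :=
  (W d.+1 :&: \bigcap_(c <- vbasis A) lker (lform d c))%VS.

Lemma cutspaceP (A : {vspace {ffun I -> k^o}}) d w :
  reflect (w \in W d.+1 /\ forall c, c \in A -> lform d c w = 0)
          (w \in cutspace A d).
Proof.
rewrite memv_cap; apply: (iffP andP) => -[wW hw]; split=> //.
  move=> c cA; rewrite (coord_vbasis cA).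
  have hb (b : {ffun I -> k^o}) : b \in vbasis A -> lform d b w = 0.
    rewrite -[b \in _]/(b \in tval (vbasis A)) => bA.
    apply/eqP; rewrite -memv_ker; move: bA hw.
    elim: (tval (vbasis A)) => // a s IH.
    rewrite inE big_cons memv_cap => h /andP[wa ws].
    by case/orP: h => [/eqP->|bs] //; apply: IH.
  apply: (big_ind (fun c => lform d c w = 0)) => [|c1 c2 h1 h2|i _].
  - by rewrite lformE big1 // => i _; rewrite ffunE scale0r.
  - by rewrite lformD h1 h2 addr0.
  - by rewrite lformZ hb ?scaler0 // mem_nth ?size_tuple.
rewrite big_seq; apply: (big_ind (fun S : {vspace _} => w \in S)) => [|S T hS hT|c cA].
- exact: memvf.
- by rewrite memv_cap hS.
by rewrite memv_ker; apply/eqP/hw/vbasis_mem.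
Qed.

Lemma lform_cut A d c w : w \in cutspace A d.+1 -> lform d.+1 c w \in cutspace A d.
Proof.
move=> /cutspaceP[wW hw]; apply/cutspaceP; split; first exact: lformW.
by move=> c' c'A; rewrite lform_comm hw // linear0.
Qed.

Lemma cutspace_eq0S A d : cutspace A d = 0%VS -> cutspace A d.+1 = 0%VS.
Proof.
move=> h; apply/eqP; rewrite -subv0; apply/subvP => w hw.
rewrite memv0; apply/eqP/Xfaithful => i.
by move: (lform_cut (dform i) hw); rewrite h memv0 lform_dform => /eqP.
Qed.

Lemma cutspace_eq0 A d e : (d <= e)%N -> cutspace A d = 0%VS -> cutspace A e = 0%VS.
Proof.
move=> /subnK <- h; elim: (e - d)%N => // n IH.
by rewrite addSn; apply: cutspace_eq0S.
Qed.

Lemma memv_cutspaceD A c d w :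
  (w \in cutspace (A + <[c]>)%VS d) = (w \in cutspace A d) && (lform d c w == 0).
Proof.
apply/cutspaceP/andP => [[wW hw]|[/cutspaceP[wW hw] /eqP hc]].
  split; last by apply/eqP/hw/(subvP (addvSr _ _))/memv_line.
  by apply/cutspaceP; split=> // c' c'A; apply/hw/(subvP (addvSl _ _)).
split=> // _ /memv_addP[a aA [_ /vlineP[t ->] ->]].
by rewrite lformD lformZ hc hw // scaler0 addr0.
Qed.

(** The quotient by A is nonzero in every positive degree: geometrically, the forms in A have a
    common projective zero on the variety with inverse system W. A maximal such A should thus be the
    space of forms vanishing at a point. *)
Definition alive A := forall d, cutspace A d != 0%VS.

Lemma alive0 : alive 0%VS.
Proof.
move=> d; apply: contra (W0 d.+1) => /eqP h; rewrite -subv0; apply/subvP=> w wW.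
rewrite -h; apply/cutspaceP; split=> // c; rewrite memv0 => /eqP ->.
by rewrite lformE big1 // => i _; rewrite ffunE scale0r.
Qed.

Lemma max_alive :
  exists2 A, alive A & forall c, c \notin A -> ~ alive (A + <[c]>)%VS.
Proof.
pose P m := `[< exists2 A, alive A & \dim A = m >].
have exP : exists m, P m.
  by exists 0; apply/asboolP; exists 0%VS; [exact: alive0 | rewrite dimv0].
have ubP m : P m -> (m <= \dim {: {ffun I -> k^o}})%N.
  by move=> /asboolP[A _ <-]; rewrite dimvS ?subvf.
case: (ex_maxnP exP ubP) => m /asboolP[A aA dA] maxA.
exists A => // c cA aAc.
have /maxA : P (\dim (A + <[c]>)) by apply/asboolP; exists (A + <[c]>)%VS.
rewrite -dA leqNgt => /negP; apply; rewrite ltn_neqAle dimvS ?addvSl // andbT.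
apply: contra cA => h.
have /eqP -> : A == (A + <[c]>)%VS by rewrite eqEdim addvSl (eqP h) /=.
by rewrite (subvP (addvSr _ _)) ?memv_line.
Qed.

(** Induction on the value at d0: either f drops somewhere beyond d0, and the argument restarts
    there, or it is constant already. *)
Lemma eventually_constant (f : nat -> nat) d0 :
  (forall d, d0 <= d -> f d.+1 <= f d)%N ->
  exists2 d1, (d0 <= d1)%N & forall d, (d1 <= d)%N -> f d.+1 = f d.
Proof.
elim: {d0}(f d0).+1 {-2}d0 (ltnSn (f d0)) => // m IH d0 hm hf.
have mono d : (d0 <= d)%N -> (f d <= f d0)%N.
  move=> /subnK <-; elim: (d - d0)%N => // j; apply: leq_trans.
  by rewrite addSn hf // leq_addl.
have [[d hd lt]|no] := pselect (exists2 d, (d0 <= d)%N & (f d.+1 < f d)%N).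
  case: (IH d.+1) => [|d' hd'|d1 hd1 hc].
  - by apply: leq_trans lt _; apply: leq_trans (mono _ hd) _.
  - by apply: hf; apply: leq_trans hd (ltnW hd').
  by exists d1 => //; apply: leq_trans hd (ltnW hd1).
exists d0 => // d hd; apply/eqP; rewrite eqn_leq hf //= leqNgt.
by apply/negP => lt; apply: no; exists d.
Qed.

(* If c and c' were independent modulo A, then c would eventually act bijectively
   on the cut spaces, so c' - t c would have a nonzero kernel for some t, and
   pulling back along c spreads this kernel to all higher degrees. *)
Lemma max_alive_codim A c c' : alive A ->
  (forall c, c \notin A -> ~ alive (A + <[c]>)%VS) ->
  c \notin A -> c' \in (A + <[c]>)%VS.
Proof.
move=> aA maxA cA; apply: contraT => c'A.
(* Since A + <[c]> is not alive, its cut space vanishes at some d0 and from there on; that cut space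
   is the kernel of c on the cut space of A. *)
have [d0 inj] : exists d0, forall d w, (d0 <= d)%N ->
    w \in cutspace A d -> lform d c w = 0 -> w = 0.
  have /existsNP[d0 /negP/negPn/eqP h0] := maxA _ cA.
  exists d0 => d w hd wA hw; apply/eqP; rewrite -memv0.
  by rewrite -(cutspace_eq0 hd h0) memv_cutspaceD wA hw eqxx.
have dimim d : (d0 <= d)%N ->
    \dim (lform d.+1 c @: cutspace A d.+1) = \dim (cutspace A d.+1).
  move=> hd; apply: limg_dim_eq; apply/eqP; rewrite -subv0; apply/subvP=> w.
  rewrite memv_cap memv_ker memv0 => /andP[wA /eqP hw].
  by apply/eqP; apply: inj hw => //; apply: leqW.
have sub d c1 : (lform d.+1 c1 @: cutspace A d.+1 <= cutspace A d)%VS.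
  by apply/subvP=> _ /memv_imgP[w wA ->]; apply: lform_cut.
have [d1 hd01 cst] : exists2 d1, (d0 <= d1)%N & forall d, (d1 <= d)%N ->
    \dim (cutspace A d.+1) = \dim (cutspace A d).
  apply: (@eventually_constant (fun d => \dim (cutspace A d))) => d hd.
  by rewrite -dimim // dimvS.
have surj d : (d1 <= d)%N -> (lform d.+1 c @: cutspace A d.+1)%VS = cutspace A d.
  move=> hd; apply/eqP; rewrite eqEdim sub dimim ?cst /= ?leqnn //.
  exact: leq_trans hd01 hd.
have [||t [w [wA w0 hw]]] := @pencil_eigenvector _ _ _ (lform d1.+1 c)
    (lform d1.+1 c') (cutspace A d1.+1); [exact: aA| by rewrite surj ?sub|].
pose c2 := c' - t *: c.
have c2A : c2 \notin A.
  apply: contra c'A => h; rewrite -[c'](subrK (t *: c)) -/c2.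
  by rewrite memv_add ?memvZ ?memv_line.
case: (maxA _ c2A) => d.
(* Vanishing propagates upwards, so nonvanishing in arbitrarily high degrees suffices. *)
have [m hm] : exists m, (d <= d1.+1 + m)%N by exists d; rewrite leq_addl.
apply/negP=> /eqP /(cutspace_eq0 hm) {hm d}; apply/eqP; rewrite -subv0.
suff [v [vA v0 hv]] : exists v, [/\ v \in cutspace A (d1.+1 + m), v != 0
    & lform (d1.+1 + m) c2 v = 0].
  apply: contra v0 => /subvP/(_ v); rewrite memv_cutspaceD vA hv eqxx memv0.
  exact.
elim: m => [|m [v [vA v0 hv]]].
  rewrite addn0; exists w; split=> //.
  by rewrite /c2 -scaleNr lformD hw lformZ scaleNr subrr.
have hle : (d1 <= d1.+1 + m)%N by rewrite addSn leqW ?leq_addr.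
have : v \in (lform (d1.+1 + m).+1 c @: cutspace A (d1.+1 + m).+1)%VS.
  by rewrite surj.
case/memv_imgP => u uA vE; rewrite addnS; exists u; split=> //.
  by apply: contra v0 => /eqP u0; rewrite vE u0 linear0.
(* With v = c u, the forms commute, so c (c2 u) = c2 v = 0, and c is injective here. *)
apply: (inj (d1.+1 + m)%N); first exact: leq_trans hle.
  exact: lform_cut.
by rewrite lform_comm -vE.
Qed.

(** Modulo a maximal alive A every X i is a multiple [la i] of one form c, and these multiples are
    the homogeneous coordinates of a point. On a nonzero functional w of degree 2 killed by A, X i X
    j then acts as [la i * la j] times c c, and faithfulness excludes z = 0 and la = 0. *)
Lemma inverse_system_point :
  exists (la : I -> k) (w : V 2) (z : V 0), [/\ (exists i, la i != 0),
    w \in W 2, z != 0 & forall i j, X 0 i (X 1 j w) = la i * la j *: z].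
Proof.
have [A aA maxA] := max_alive.
have [c cA] : exists c, c \notin A.
  apply: contrapT => /forallNP h; have := aA 0; rewrite -subv0 => /negP; apply.
  apply/subvP=> w /cutspaceP[_ hw]; rewrite memv0; apply/eqP/Xfaithful => i.
  by rewrite -lform_dform hw //; apply/negPn/negP/h.
have /choice[la hla] i : exists l, dform i - l *: c \in A.
  have /memv_addP[a aA' [_ /vlineP[l ->] ->]] := max_alive_codim (dform i) aA maxA cA.
  by exists l; rewrite addrK.
have XE d w i : w \in cutspace A d -> X d i w = la i *: lform d c w.
  move=> /cutspaceP[_ hw]; rewrite -lform_dform -[dform i](subrK (la i *: c)).
  by rewrite lformD hw // add0r lformZ.
have [w [wA w0]] : exists w, w \in cutspace A 1 /\ w != 0.
  by exists (vpick (cutspace A 1)); rewrite memv_pick vpick0 aA.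
have XXE i j : X 0 i (X 1 j w) = la i * la j *: lform 0 c (lform 1 c w).
  by rewrite (XE 1) // linearZ /= XE ?lform_cut // scalerA mulrC.
exists la, w, (lform 0 c (lform 1 c w)); split=> //; last 2 first.
- by case/cutspaceP: wA.
- apply: contra w0 => /eqP z0; apply/eqP/Xfaithful => j; apply: Xfaithful => i.
  by rewrite XXE z0 scaler0.
apply: contrapT => /forallNP h; move/eqP: w0; apply; apply: Xfaithful => i.
by rewrite XE //; have /negP/negPn/eqP -> := h i; rewrite scale0r.
Qed.

End InverseSystem.

(** * Growth of an inverse system cut by finitely many linear forms *)

Lemma leq_expn2r j m n : m <= n -> m ^ j <= n ^ j.
Proof. by case: j => // j; rewrite leq_exp2r. Qed.

Section Growth.
Local Open Scope ring_scope.
Variables (k : closedFieldType) (I : finType) (V : nat -> vectType k).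
Variable X : forall d, I -> 'Hom(V d.+1, V d).
Hypothesis Xcomm : forall d i j w, X d i (X d.+1 j w) = X d j (X d.+1 i w).
Hypothesis Xfaithful : forall d w, (forall i, X d i w = 0) -> w = 0.
Variable f : nat -> {ffun I -> k^o}.

(** Dual of the degree d component of the quotient by the forms f 0, ..., f (s - 1). Forms lower the
    degree, so degree 0 carries no condition. *)
Fixpoint killed s : forall d, {vspace V d} :=
  match s with
  | 0 => fun=> fullv
  | s'.+1 => fun d => match d with
    | 0 => fullv
    | d'.+1 => (killed s' d'.+1 :&: lker (lform X d' (f s')))%VS
    end
  end.

Lemma killed0 s : killed s 0 = fullv. Proof. by case: s. Qed.

Lemma killedP s d w :
  reflect (forall j, (j < s)%N -> lform X d (f j) w = 0) (w \in killed s d.+1).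
Proof.
elim: s => [|s IH] /=; first by rewrite memvf; constructor.
rewrite memv_cap memv_ker; apply: (iffP andP) => [[/IH h /eqP hs] j|h].
  by rewrite ltnS leq_eqVlt => /orP[/eqP->|/h].
split; last by apply/eqP/h.
by apply/IH => j js; apply/h/leqW.
Qed.

Lemma lform_killed s d c w : w \in killed s d.+1 -> lform X d c w \in killed s d.
Proof.
case: d w => [|d] w; first by rewrite killed0 memvf.
move=> /killedP h; apply/killedP => j js.
by rewrite lform_comm // h // linear0.
Qed.

Lemma killed_closed s d i w : w \in killed s d.+1 -> X d i w \in killed s d.
Proof. by rewrite -lform_dform; apply: lform_killed. Qed.

Lemma killed_eq0 s d e : (d <= e)%N -> killed s d = 0%VS -> killed s e = 0%VS.
Proof.
move=> /subnK <- h; elim: (e - d)%N => // n IH; rewrite addSn.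
apply/eqP; rewrite -subv0; apply/subvP => w hw.
rewrite memv0; apply/eqP/Xfaithful => i.
by move: (killed_closed i hw); rewrite IH memv0 => /eqP.
Qed.

(** Rank-nullity for f s on [killed s d.+1]: its kernel is [killed s.+1 d.+1] and its image lies in
    [killed s d]. *)
Lemma dim_killedS s d :
  (\dim (killed s d.+1) <= \dim (killed s.+1 d.+1) + \dim (killed s d))%N.
Proof.
rewrite /= -(limg_ker_dim (lform X d (f s)) (killed s d.+1)) leq_add2l.
by apply/dimvS/subvP=> _ /memv_imgP[w hw ->]; apply: lform_killed.
Qed.

Lemma dim_killed_sum s d :
  (\dim (killed s d) <= \sum_(0 <= e < d.+1) \dim (killed s.+1 e))%N.
Proof.
elim: d => [|d IH]; first by rewrite big_nat1 !killed0.
rewrite big_nat_recr //= addnC; apply: leq_trans (dim_killedS s d) _.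
by rewrite leq_add2l.
Qed.

(** Dropping one form replaces dimensions by at most their partial sums, which raises the order of
    growth by at most one. Starting from r forms that leave only finitely many nonzero degrees, one
    reaches the whole system after r such steps. *)
Lemma killed_growth r d0 : killed r d0 = 0%VS ->
  exists C, forall d, (\sum_(0 <= e < d.+1) \dim {: V e} <= C * d.+1 ^ r)%N.
Proof.
move=> h0; suff H j : (j <= r)%N -> exists C, forall d,
    (\sum_(0 <= e < d.+1) \dim (killed (r - j) e) <= C * d.+1 ^ j)%N.
  have [C hC] := H r (leqnn r); exists C => d.
  by move: (hC d); rewrite subnn.
elim: j => [|j IH] jr.
  (* Without dropped forms only the degrees below d0 contribute, so the partial sums are bounded. *)
  exists (\sum_(0 <= e < d0) \dim (killed r e))%N => d; rewrite subn0 muln1.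
  have [hd|hd] := leqP d.+1 d0.
    rewrite [leqRHS](@big_cat_nat _ _ _ d.+1) //=.
    exact: leq_addr.
  rewrite (@big_cat_nat _ _ _ d0) //=; last exact: ltnW.
  rewrite [X in (_ + X)%N]big_nat [X in (_ + X)%N]big1 ?addn0 // => e /andP[he _].
  by rewrite (killed_eq0 he h0) dimv0.
have [C hC] := IH (ltnW jr); exists C => d.
apply: leq_trans (_ : \sum_(0 <= e < d.+1) C * d.+1 ^ j <= _)%N; last first.
  by rewrite sum_nat_const_nat subn0 mulnCA expnS.
rewrite !big_mkord; apply: leq_sum => e _.
apply: leq_trans (dim_killed_sum _ _) _; rewrite -subSn //.
apply: leq_trans (hC e) _; by rewrite leq_mul2l leq_expn2r ?orbT.
Qed.

End Growth.

(** * Monomials as sorted tuples *)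

Section SortedTuples.

(* A sorted d-tuple encodes a monomial of degree d in m + 1 variables. *)
Definition stuple m d :=
  {t : d.-tuple 'I_m.+1 | sorted leq (map val t)}.

Lemma card_stuple m d : #|{: stuple m d}| = 'C(d + m, d).
Proof. by rewrite card_sig -card_sorted_tuples cardsE. Qed.

Definition ordle m : rel 'I_m.+1 := fun i j => i <= j.

Lemma sort_ordP m (s t : seq 'I_m.+1) :
  reflect (sort (@ordle m) s = sort (@ordle m) t) (perm_eq s t).
Proof.
apply: perm_sortP => [i j|i j l|i j].
- exact: leq_total.
- exact: leq_trans.
- by rewrite /ordle -eqn_leq => /eqP/val_inj.
Qed.

Lemma stuple_ins_subproof m d (i : 'I_m.+1) (t : stuple m d) :
  sorted leq (map val (sort_tuple (@ordle m) [tuple of i :: val t])).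
Proof.
rewrite sorted_map; apply: (@sort_sorted _ (@ordle m)) => a b.
exact: leq_total.
Qed.

(** Multiplication of a monomial by the variable i; sorting restores the normal form. *)
Definition stuple_ins m d (i : 'I_m.+1) (t : stuple m d) : stuple m d.+1 :=
  exist (fun t : d.+1.-tuple 'I_m.+1 => sorted leq (map val t))
    _ (stuple_ins_subproof i t).

Lemma stuple_insC m d (i j : 'I_m.+1) (t : stuple m d) :
  stuple_ins i (stuple_ins j t) = stuple_ins j (stuple_ins i t).
Proof.
apply/val_inj/val_inj/sort_ordP => /=.
have h l : perm_eq (sort (@ordle m) (l :: val t)) (l :: val t).
  by rewrite perm_sort.
rewrite (perm_catl [:: i] (h j)) /= perm_sym (perm_catl [:: j] (h i)) /=.
by rewrite (perm_catCA [:: j] [:: i]).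
Qed.

Lemma stuple_ins_surj m d (t : stuple m d.+1) : exists i t', stuple_ins i t' = t.
Proof.
case: t => -[[|i s] // hs] st; have hs' : size s == d by [].
have ss : sorted leq (map val (Tuple hs')) by move: st => /= /path_sorted.
pose t' : stuple m d :=
  exist (fun t : d.-tuple 'I_m.+1 => sorted leq (map val t)) (Tuple hs') ss.
exists i, t'; apply/val_inj/val_inj => /=.
apply: (@sorted_sort _ (@ordle m)) => [? ? ?|]; first exact: leq_trans.
by rewrite sorted_map in st.
Qed.

End SortedTuples.

(** * Numerical estimates for the growth of the Segre ring *)

Section SegreGrowth.

(** The right-hand side is the falling factorial (e + a) ... (e + 1), with a factors that are all at
    least e + 1. *)
Lemma leq_exp_binomial a e : e.+1 ^ a <= 'C(e + a, e) * a`!.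
Proof.
have -> : 'C(e + a, e) = 'C(e + a, a) by rewrite -bin_sub ?leq_addr // addKn.
rewrite bin_ffact; elim: a => // a IH.
by rewrite expnS addnS ffactSS leq_mul // ltnS leq_addr.
Qed.

Lemma sum_exp_not_bounded C N :
  ~ forall d, \sum_(0 <= e < d.+1) e.+1 ^ N <= C * d.+1 ^ N.
Proof.
(* For d + 1 = 2m the upper half of the sum alone is at least m * m ^ N, which exceeds C * (2m) ^ N
   as soon as m > C * 2 ^ N. *)
move=> h; pose m := (C * 2 ^ N).+1.
have := h m.*2.-1; rewrite prednK ?double_gt0 // leqNgt => /negP; apply.
rewrite (@big_cat_nat _ _ _ m) //=; last by rewrite -addnn leq_addr.
apply: leq_trans (leq_addl _ _).
apply: (@leq_trans (\sum_(m <= e < m.*2) m ^ N)).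
  rewrite sum_nat_const_nat -addnn addnK addnn -mul2n expnMn mulnA.
  by rewrite ltn_pmul2r ?expn_gt0.
by rewrite !big_nat; apply: leq_sum => e /andP[me _]; rewrite leq_expn2r // leqW.
Qed.

End SegreGrowth.

(** [linfun] accepts an arbitrary function; this evaluates it from a mere proof of linearity,
    without a declared linear structure. *)
Lemma linfunE (K : fieldType) (aT rT : vectType K) (f : aT -> rT) :
  linear f -> linfun f =1 f.
Proof.
move=> fL v.
pose fl : {linear aT -> rT} := HB.pack f (GRing.isLinear.Build _ _ _ _ f fL).
exact: (lfunE fl v).
Qed.

(** * Common zeros of bilinear forms *)

Section BilinearZero.
Local Open Scope ring_scope.
Variables (k : closedFieldType) (a b : nat).

(** Dual of the degree d component of the Segre ring, whose basis consists of pairs of degree d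
    monomials in a + 1 and in b + 1 variables. [contraction] is the transpose of multiplication by
    x_i y_j. *)
Definition segre_dual d : vectType k := {ffun stuple a d * stuple b d -> k^o}.

Definition contraction d (p : 'I_a.+1 * 'I_b.+1) :
    'Hom(segre_dual d.+1, segre_dual d) :=
  linfun (fun phi : segre_dual d.+1 =>
    [ffun q => phi (stuple_ins p.1 q.1, stuple_ins p.2 q.2)] : segre_dual d).

Lemma contractionE d p phi q :
  contraction d p phi q = phi (stuple_ins p.1 q.1, stuple_ins p.2 q.2).
Proof.
rewrite linfunE ?ffunE // => t u v; apply/ffunP => q'.
by rewrite !ffunE.
Qed.

Lemma contractionC d p p' w :
  contraction d p (contraction d.+1 p' w) = contraction d p' (contraction d.+1 p w).
Proof.
apply/ffunP => q; rewrite !contractionE /=.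
by rewrite (stuple_insC p'.1 p.1) (stuple_insC p'.2 p.2).
Qed.

Lemma contraction_faithful d w : (forall p, contraction d p w = 0) -> w = 0.
Proof.
move=> h; apply/ffunP => -[s t].
have [i [s' <-]] := stuple_ins_surj s; have [j [t' <-]] := stuple_ins_surj t.
by move/ffunP: (h (i, j)) => /(_ (s', t')); rewrite contractionE !ffunE.
Qed.

(** Transpose of the Segre relations, the 2 x 2 minors of the matrix (x_i y_j). *)
Lemma contraction_swap d i i' j j' w :
  contraction d (i, j) (contraction d.+1 (i', j') w) =
  contraction d (i, j') (contraction d.+1 (i', j) w).
Proof.
by apply/ffunP => q; rewrite !contractionE /= [stuple_ins j' (stuple_ins j _)]stuple_insC.
Qed.

Lemma dim_segre_dual d : \dim {: segre_dual d} = ('C(d + a, d) * 'C(d + b, d))%N.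
Proof. by rewrite dimvf /dim /= muln1 card_prod !card_stuple. Qed.

Lemma bilinear_zero r (F : nat -> 'M[k]_(a.+1, b.+1)) : (r <= a + b)%N ->
  exists (u : 'rV[k]_a.+1) (v : 'rV[k]_b.+1), [/\ u != 0, v != 0 &
    forall s, (s < r)%N -> \sum_i \sum_j F s i j * (u 0 i * v 0 j) = 0].
Proof.
move=> rab; pose f s : {ffun 'I_a.+1 * 'I_b.+1 -> k^o} := [ffun p => F s p.1 p.2].
pose W d := killed contraction f r d.
(* If W vanished in some degree, the partial sums of the dimensions would be O(d^r), hence
   O(d^(a+b)); but the dimension in degree e is at least (e + 1)^(a + b) / (a! b!), so they grow
   faster. *)
have W0 d : W d != 0%VS.
  apply/eqP => /(killed_growth contractionC contraction_faithful)[C hC].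
  apply: (@sum_exp_not_bounded (a`! * b`! * C) (a + b)) => e.
  apply: (@leq_trans (\sum_(0 <= e0 < e.+1) a`! * b`! * \dim {: segre_dual e0})).
    apply: leq_sum => i _; rewrite expnD dim_segre_dual mulnACA leq_mul //.
      by rewrite mulnC leq_exp_binomial.
    by rewrite mulnC leq_exp_binomial.
  rewrite -big_distrr /= -[leqRHS]mulnA leq_mul2l; apply/orP; right.
  by apply: leq_trans (hC e) _; rewrite leq_mul2l leq_pexp2l ?orbT.
have [la [w [z [[[i0 j0] la0] wW z0 hXX]]]] := inverse_system_point
  contractionC contraction_faithful
  (fun d i w => @killed_closed _ _ _ _ contractionC f r d i w) W0.
(* The 2 x 2 minors of la vanish, so la has rank one and is, up to a scalar, the product of its
   column j0 and its row i0. *)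
have swap i i' j j' : la (i, j) * la (i', j') = la (i, j') * la (i', j).
  have /eqP := contraction_swap i i' j j' w.
  by rewrite !hXX -subr_eq0 -scalerBl scaler_eq0 (negPf z0) orbF subr_eq0 => /eqP.
exists (\row_i la (i, j0)), (\row_j la (i0, j)); split.
- by apply: contra la0 => /eqP/rowP/(_ i0); rewrite !mxE => ->.
- by apply: contra la0 => /eqP/rowP/(_ j0); rewrite !mxE => ->.
move=> s sr; have/killedP/(_ s sr) hs := wW.
(* Contracting f s w = 0 once more by (i0, j0) gives la (i0, j0) times this sum times z, where la
   (i0, j0) and z are nonzero. *)
have : \sum_p f s p * la p = 0.
  have : contraction 0 (i0, j0) (lform contraction 1 (f s) w) = 0.
    by rewrite hs linear0.
  rewrite lformE linear_sum /=.
  under eq_bigr do rewrite linearZ /= hXX scalerA.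
  rewrite -scaler_suml => /eqP; rewrite scaler_eq0 (negPf z0) orbF.
  have -> : \sum_p f s p * (la (i0, j0) * la p) = la (i0, j0) * \sum_p f s p * la p.
    by rewrite mulr_sumr; apply: eq_bigr => p _; apply: mulrCA.
  by rewrite mulf_eq0 (negPf la0) => /eqP.
move=> h; rewrite pair_big /=.
transitivity (\sum_p (f s p * la p) * la (i0, j0)); last first.
  by rewrite -mulr_suml h mul0r.
apply: eq_bigr => -[i j] _ /=; rewrite !mxE ffunE -mulrA; congr (_ * _).
by rewrite swap.
Qed.

End BilinearZero.

(** * Upper bound for spaces of injective maps *)

Section RankProperty.
Local Open Scope ring_scope.

Lemma lker_lin_rank (k : fieldType) y r (v : lin_maps k y r) :
  (lin_rank v == y) = (lker v == 0%VS).
Proof.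
rewrite /lin_rank -dimv_eq0; have := limg_ker_dim v fullv.
rewrite capfv dimvf /dim /= mul1n; lia.
Qed.

(** In a larger H the r coordinates of (sum of u_i e_i)(v), for a basis e of H, are bilinear forms
    in (u, v) with a common zero u, v != 0. This yields a nonzero member of H with v in its
    kernel. *)
Lemma rank_property_dim (k : closedFieldType) y r (H : {vspace lin_maps k y r}) :
  (0 < y)%N -> rank_property H -> (\dim H <= r.+1 - y)%N.
Proof.
move=> y0 hH; rewrite leqNgt; apply/negP => hd.
case: y => [//|b] in H y0 hH hd *.
have [a ea] : exists a, \dim H = a.+1.
  by exists (\dim H).-1; rewrite prednK // (leq_trans _ hd).
pose e (i : nat) := (vbasis H)`_i.
(* [bilinear_zero] takes forms indexed by all naturals; those from r on are set to 0. *)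
pose F s : 'M[k]_(a.+1, b.+1) := \matrix_(i, j)
  (if insub s is Some t then e i (delta_mx 0 j) 0 t else 0).
have FE (s : 'I_r) i j : F s i j = e i (delta_mx 0 j) 0 s by rewrite mxE valK.
have rab : (r <= a + b)%N by lia.
have [u [v [u0 v0 huv]]] := bilinear_zero F rab.
pose h := \sum_(i < a.+1) u 0 i *: e i.
have hE : h v = 0.
  apply/rowP => s; transitivity (0 : k); last by rewrite mxE.
  rewrite -(huv s (ltn_ord s)).
  rewrite /h sum_lfunE summxE; apply: eq_bigr => i _.
  rewrite scale_lfunE mxE {1}(row_sum_delta v) linear_sum summxE mulr_sumr.
  apply: eq_bigr => j _; rewrite linearZ /= FE.
  have -> : (v 0 j *: e i (delta_mx 0 j)) 0 s = v 0 j * e i (delta_mx 0 j) 0 s.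
    by rewrite mxE.
  by rewrite [RHS]mulrC mulrA.
have hh : h \in H.
  apply: memv_suml => l _; rewrite memvZ // vbasis_mem // mem_nth //.
  by rewrite size_tuple ea.
have h0 : h != 0.
  apply: contra u0 => /eqP h0; apply/eqP/rowP => i; rewrite mxE.
  pose c (j : nat) := if insub j is Some l then u 0 l else 0.
  have hsum : \sum_(j < \dim H) c j *: e j = 0.
    rewrite -(big_mkord xpredT (fun j => c j *: e j)) ea big_mkord -[RHS]h0 /h.
    by apply: eq_bigr => j _; rewrite /c valK.
  have := basis_free (vbasisP H) => /freeP /(_ _ hsum (cast_ord (esym ea) i)).
  by rewrite /c /= valK.
have := hH h hh h0; move/eqP; rewrite lker_lin_rank => /eqP hk.
by move/negP: v0; apply; rewrite -memv0 -hk memv_ker hE.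
Qed.

End RankProperty.

(** * Dimension formulas and annihilators *)

Section Dimensions.
Local Open Scope ring_scope.
Variable k : fieldType.

Lemma dim_ko : \dim {: k^o} = 1%N.
Proof. by rewrite dimvf. Qed.

Lemma dim_rV n : \dim {: 'rV[k]_n} = n.
Proof. by rewrite dimvf /dim /= mul1n. Qed.

Lemma dim_Hom (U V : vectType k) : \dim {: 'Hom(U, V)} = (\dim {: U} * \dim {: V})%N.
Proof. by rewrite !dimvf. Qed.

Lemma dim_prod (U V : vectType k) : \dim {: (U * V)%type} = (\dim {: U} + \dim {: V})%N.
Proof. by rewrite !dimvf. Qed.

Lemma dim_ffun (I : finType) (V : vectType k) :
  \dim {: {ffun I -> V}} = (#|I| * \dim {: V})%N.
Proof. by rewrite !dimvf. Qed.

Lemma dim_subvs (V : vectType k) (U : {vspace V}) : \dim {: subvs_of U} = \dim U.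
Proof. by rewrite dimvf. Qed.

Lemma lker0_limg (U V : vectType k) (f : 'Hom(U, V)) :
  lker f = 0%VS -> \dim {: U} = \dim {: V} -> limg f = fullv.
Proof.
by move=> f0 d; apply/eqP; rewrite eqEdim subvf limg_dim_eq ?f0 ?capv0 ?d /=.
Qed.

Lemma lker0I (U V : vectType k) (f : 'Hom(U, V)) :
  (forall u, f u = 0 -> u = 0) -> lker f = 0%VS.
Proof.
move=> h; apply/eqP; rewrite -subv0; apply/subvP => u; rewrite memv_ker => /eqP/h ->.
exact: mem0v.
Qed.

Lemma linear_comp_lfun (S T R : vectType k) (D : 'Hom(S, T)) :
  linear (fun phi : 'Hom(T, R) => (phi \o D)%VF).
Proof. by move=> c f g; rewrite comp_lfunDl comp_lfunZl. Qed.

(** The forms vanishing on the image of D are the kernel of restriction to that image, and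
    restriction is onto because a form extends along the projection. *)
Lemma dim_annihilator (S T : vectType k) (D : 'Hom(S, T)) :
  (\dim (lker (linfun (fun phi : 'Hom(T, k^o) => (phi \o D)%VF))) + \dim (limg D)
   = \dim {: T})%N.
Proof.
set U := limg D; pose iota : 'Hom(subvs_of U, T) := linfun vsval.
pose res := linfun (fun phi : 'Hom(T, k^o) => (phi \o iota)%VF).
have resE phi : res phi = (phi \o iota)%VF by rewrite linfunE //; apply: linear_comp_lfun.
have -> : lker (linfun (fun phi : 'Hom(T, k^o) => (phi \o D)%VF)) = lker res.
  apply/vspaceP => phi; rewrite !memv_ker resE linfunE; last exact: linear_comp_lfun.
  apply/eqP/eqP => h; apply/lfunP => u; rewrite comp_lfunE zero_lfunE.
    rewrite lfunE /=; have /memv_imgP[w _ ->] := subvsP u.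
    by rewrite -comp_lfunE h zero_lfunE.
  have hu : D u \in U by rewrite memv_img ?memvf.
  by rewrite -[D u](vsprojK hu) -(lfunE vsval) -comp_lfunE h zero_lfunE.
have := limg_ker_dim res fullv; rewrite capfv dim_Hom dim_ko muln1 => <-; congr (_ + _)%N.
suff -> : limg res = fullv by rewrite dim_Hom dim_ko muln1 dim_subvs.
apply/vspaceP => psi; rewrite memvf; apply/memv_imgP.
exists (psi \o linfun (vsproj U) \o projv U)%VF; rewrite ?memvf // resE.
apply/lfunP => u; rewrite !comp_lfunE !lfunE /= projv_id ?subvsP //.
by rewrite vsvalK.
Qed.

End Dimensions.

(** * Dimension vectors under the Auslander-Reiten translation *)

Section TauDimension.
Local Open Scope ring_scope.
Variables (k : fieldType) (r : nat).
Implicit Types M N : krep k r.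

Lemma ext_diffE M N u j :
  ext_diff M N u j = ((u.2 \o gam M j)%VF - (gam N j \o u.1)%VF).
Proof.
rewrite /ext_diff linfunE ?ffunE // => c v w; apply/ffunP => i.
rewrite !ffunE /= scalerBr comp_lfunZl comp_lfunZr comp_lfunDl comp_lfunDr.
by rewrite opprD addrACA.
Qed.

(** The kernel of [ext_diff] is Hom(M, N), so this is the Euler form formula for dim Hom - dim
    Ext^1, written without subtraction. *)
Lemma dim_DExt1 M N :
  (\dim (DExt1 M N) +
     (\dim {: rep1 M} * \dim {: rep1 N} + \dim {: rep2 M} * \dim {: rep2 N})
   = r * (\dim {: rep1 M} * \dim {: rep2 N}) + \dim (lker (ext_diff M N)))%N.
Proof.
have h1 := dim_annihilator (ext_diff M N).
have h2 := limg_ker_dim (ext_diff M N) fullv.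
rewrite capfv dim_prod !dim_Hom in h2.
rewrite -/(DExt1 M N) dim_ffun dim_Hom card_ord in h1.
by rewrite -h1 -h2 -addnA (addnC (\dim (lker _))).
Qed.

(* The kernels are Hom(M, P(2)) and Hom(M, P(1)), and P(2)^r is the radical of
   P(1). *)
Lemma dim_lker_ext_proj M :
  (r * \dim (lker (ext_diff M (proj2 k r))) <= \dim (lker (ext_diff M (proj1 k r))))%N.
Proof.
set K2 := lker (ext_diff M (proj2 k r)); set K1 := lker _.
(* A family of r homomorphisms to P(2) is assembled along the r embeddings into one homomorphism to
   P(1), whose coordinates recover the family. *)
pose g (t : {ffun 'I_r -> subvs_of K2}) :
    ('Hom(rep1 M, k^o) * 'Hom(rep2 M, 'rV[k]_r))%type :=
  (0, \sum_j (proj1_emb k j \o (vsval (t j)).2)%VF).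
have gL : linear g.
  move=> c s t; congr (_, _); first by rewrite /= scaler0 addr0.
  rewrite /= scaler_sumr -big_split /=; apply: eq_bigr => j _.
  by rewrite !ffunE linearP /= comp_lfunZr comp_lfunDr.
have embE j c : proj1_emb k j c = c *: delta_mx 0 j :> 'rV[k]_r.
  by rewrite /proj1_emb linfunE // => d u v; rewrite scalerDl scalerA.
have gE t v i : (g t).2 v 0 i = (vsval (t i)).2 v.
  rewrite sum_lfunE summxE (bigD1 i) //= big1 ?addr0.
    by rewrite comp_lfunE embE !mxE !eqxx mulr1.
  by move=> j ji; rewrite comp_lfunE embE !mxE eq_sym (negPf ji) andbF mulr0.
have ker2 (s : subvs_of K2) j v : (vsval s).2 (gam M j v) = 0.
  have := subvsP s; rewrite memv_ker => /eqP/ffunP/(_ j).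
  rewrite ext_diffE /= ffunE => /lfunP/(_ v).
  by rewrite add_lfunE opp_lfunE !comp_lfunE !zero_lfunE subr0.
have inj : lker (linfun g) = 0%VS.
  apply: lker0I => t; rewrite linfunE // => gt0; apply/ffunP => i; rewrite ffunE.
  apply: val_inj; rewrite /=; case E: (vsval (t i)) => [s1 s2]; congr (_, _).
    by apply/lfunP => v; apply/rowP => -[].
  apply/lfunP => v; rewrite zero_lfunE; have := gE t v i; rewrite gt0 E /= => <-.
  by rewrite zero_lfunE mxE.
have sub : (limg (linfun g) <= K1)%VS.
  apply/subvP=> _ /memv_imgP[t _ ->]; rewrite linfunE // memv_ker.
  apply/eqP/ffunP => j; rewrite ext_diffE ffunE; apply/lfunP => v.
  rewrite add_lfunE opp_lfunE !comp_lfunE zero_lfunE linear0 subr0.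
  by apply/rowP => i; rewrite gE ker2 zero_lfunE mxE.
by move/dimvS: sub; rewrite limg_dim_eq ?inj ?capv0 // dim_ffun card_ord dim_subvs.
Qed.

(* Up to the corrections h1 and h2, which vanish if M has no projective summand,
   this is the Coxeter transformation (a, b) |-> ((r^2 - 1) a - r b, r a - b). *)
Lemma tau_dims M (a := \dim {: rep1 M}) (b := \dim {: rep2 M})
    (a' := \dim {: rep1 (tau M)}) (b' := \dim {: rep2 (tau M)}) :
  exists h1 h2, [/\ (r * h2 <= h1)%N, (a' + (a + b * r) = r * (a * r) + h1)%N
    & (b' + b = r * a + h2)%N].
Proof.
exists (\dim (lker (ext_diff M (proj1 k r)))), (\dim (lker (ext_diff M (proj2 k r)))).
split; first exact: dim_lker_ext_proj.
  by have := dim_DExt1 M (proj1 k r); rewrite dim_ko dim_rV muln1 /a' dim_subvs.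
by have := dim_DExt1 M (proj2 k r); rewrite dim_ko dim_rV !muln1 muln0 /b' dim_subvs.
Qed.

(** Put q = r - 1 and let c = q a - b be the slack. The Coxeter formulas become a' = q a + r c + h1
    and b' = a + c + h2, and r h2 <= h1 with q >= 2 gives b' <= q a'. *)
Lemma tau_slope M : (3 <= r)%N ->
  (0 < \dim {: rep1 M})%N -> (\dim {: rep2 M} <= r.-1 * \dim {: rep1 M})%N ->
  (0 < \dim {: rep1 (tau M)})%N /\
  (\dim {: rep2 (tau M)} <= r.-1 * \dim {: rep1 (tau M)})%N.
Proof.
move=> r3 a0 ba; have [h1 [h2 [hh]]] := tau_dims M.
move: (\dim {: rep1 M}) (\dim {: rep2 M}) a0 ba hh.
move: (\dim {: rep1 (tau M)}) (\dim {: rep2 (tau M)}).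
move=> a' b' a b; case: r r3 => [//|q]; rewrite /= => q2 a0 ba hh e1 e2.
have [c hc] : exists c, (b + c = q * a)%N by exists (q * a - b)%N; rewrite subnKC.
have [l hl] : exists l, (h1 = q.+1 * h2 + l)%N.
  by exists (h1 - q.+1 * h2)%N; rewrite subnKC.
have ea' : (a' = q * a + q.+1 * c + h1)%N by nia.
split; first by nia.
have eb' : (b' = a + c + h2)%N by nia.
by rewrite ea' eb' hl; nia.
Qed.

End TauDimension.

(** * Regularity of modules of small dimension *)

Section Regularity.
Local Open Scope ring_scope.
Variables (k : fieldType) (r : nat).
Implicit Types M N X Y L : krep k r.

Definition d1 M := \dim {: rep1 M}.
Definition d2 M := \dim {: rep2 M}.

Lemma d1_dual M : d1 (dual_rep M) = d2 M.
Proof. by rewrite /d1 dim_Hom dim_ko muln1. Qed.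

Lemma d2_dual M : d2 (dual_rep M) = d1 M.
Proof. by rewrite /d2 dim_Hom dim_ko muln1. Qed.

Lemma tauV_slope M : (3 <= r)%N -> (0 < d2 M)%N -> (d1 M <= r.-1 * d2 M)%N ->
  (0 < d2 (tauV M))%N /\ (d1 (tauV M) <= r.-1 * d2 (tauV M))%N.
Proof.
move=> r3 a0 ba; rewrite /tauV d1_dual d2_dual.
by apply: tau_slope; rewrite // -/(d1 _) -/(d2 _) ?d1_dual ?d2_dual.
Qed.

Lemma tau_pow_neq0 M t : (3 <= r)%N -> (0 < d1 M)%N -> (0 < d2 M)%N ->
  (d1 M <= r.-1)%N -> (d2 M <= r.-1)%N -> ~ rep_zero (tau_pow t M).
Proof.
move=> r3 a0 b0 ar br [h1 h2].
have le1 : (d2 M <= r.-1 * d1 M)%N by apply: leq_trans br _; apply: leq_pmulr.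
have le2 : (d1 M <= r.-1 * d2 M)%N by apply: leq_trans ar _; apply: leq_pmulr.
case: t => n in h1 h2.
  suff [] : (0 < d1 (iter n (@tau k r) M))%N /\
      (d2 (iter n (@tau k r) M) <= r.-1 * d1 (iter n (@tau k r) M))%N.
    by rewrite /d1 h1.
  by elim: n {h1 h2} => //= n [? ?]; apply: tau_slope.
suff [] : (0 < d2 (iter n.+1 (@tauV k r) M))%N /\
    (d1 (iter n.+1 (@tauV k r) M) <= r.-1 * d2 (iter n.+1 (@tauV k r) M))%N.
  by rewrite /d2 h2.
elim: {h1 h2}n.+1 => //= m [? ?]; exact: tauV_slope.
Qed.

Lemma d1_eq0_tau M : d1 M = 0%N -> rep_zero (tau M).
Proof.
rewrite /d1 => M0; have h N : \dim (DExt1 M N) = 0%N.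
  apply/eqP; rewrite -leqn0; apply: leq_trans (dimvS (subvf _)) _.
  by rewrite dim_Hom dim_ffun dim_Hom M0 !muln0.
by split; rewrite dim_subvs h.
Qed.

Lemma regular_indec_d1 M : regular_indec M -> (0 < d1 M)%N.
Proof. by rewrite lt0n => -[_ h]; apply/eqP => /d1_eq0_tau; apply: (h 1%Z). Qed.

Lemma regular_indec_d2 M : regular_indec M -> (0 < d2 M)%N.
Proof.
(* [Negz 0] is the exponent -1, that is, the inverse translation. *)
rewrite lt0n => -[_ h]; apply/eqP => M0; apply: (h (Negz 0)) => /=.
have [e1 e2] : rep_zero (tau (dual_rep M)) by apply: d1_eq0_tau; rewrite d1_dual.
by split; rewrite ?[LHS]d1_dual ?[LHS]d2_dual.
Qed.

(** For finite-dimensional modules, [full] excludes the simple projective (0, k) as a direct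
    summand, and [faithful] the simple injective (k, 0). *)
Definition full M : Prop := (\sum_j limg (gam M j))%VS = fullv.
Definition faithful M : Prop := forall m, (forall j, gam M j m = 0) -> m = 0.

Lemma dim_rep_sum X Y :
  d1 (rep_sum X Y) = (d1 X + d1 Y)%N /\ d2 (rep_sum X Y) = (d2 X + d2 Y)%N.
Proof. by rewrite /d1 /d2 !dim_prod. Qed.

Lemma rep_iso_dim M N : rep_iso M N -> d1 M = d1 N /\ d2 M = d2 N.
Proof.
case=> f [[i1 i2] [s1 s2]]; rewrite /d1 /d2 -s1 -s2.
by rewrite !limg_dim_eq ?i1 ?i2 ?capv0.
Qed.

Lemma khom_rep_iso M N (f : khom M N) : rep_inj f ->
  d1 M = d1 N -> d2 M = d2 N -> rep_iso M N.
Proof. by move=> [i1 i2] e1 e2; exists f; split; split=> //; apply: lker0_limg. Qed.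

Lemma khomE M N (f : khom M N) j m : hom2 f (gam M j m) = gam N j (hom1 f m).
Proof. by have /lfunP/(_ m) := khom_comm f j; rewrite !comp_lfunE. Qed.

Lemma gam_sumE X Y j m : gam (rep_sum X Y) j m = (gam X j m.1, gam Y j m.2).
Proof. by rewrite /= linfunE // => c u v; rewrite !linearP. Qed.

Lemma limg_surj (U V : vectType k) (f : 'Hom(U, V)) v :
  limg f = fullv -> exists u, v = f u.
Proof.
move=> s; have /memv_imgP[u _ ->] : v \in limg f by rewrite s memvf.
by exists u.
Qed.

Lemma lker_inj (U V : vectType k) (f : 'Hom(U, V)) u : lker f = 0%VS -> f u = 0 -> u = 0.
Proof. by move=> i /eqP; rewrite -memv_ker i memv0 => /eqP. Qed.

Lemma summand_faithful M X Y : faithful M -> rep_iso M (rep_sum X Y) -> faithful X.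
Proof.
move=> fM [f [[i1 i2] [s1 s2]]] x hx.
have [m hm] := limg_surj (x, 0) s1.
suff m0 : m = 0 by move: hm; rewrite m0 linear0 => -[].
apply: fM => j; apply: (lker_inj i2).
by rewrite khomE -hm gam_sumE /= hx linear0.
Qed.

Lemma fullP M (P : rep2 M -> Prop) : full M -> P 0 ->
  (forall u v, P u -> P v -> P (u + v)) -> (forall j m, P (gam M j m)) ->
  forall v, P v.
Proof.
move=> fM P0 PD Pg v; have : v \in (\sum_j limg (gam M j))%VS by rewrite fM memvf.
case/memv_sumP => w hw ->; elim/big_ind: _ => // j _.
by have /memv_imgP[m _ ->] := hw j isT.
Qed.

Lemma summand_d1_eq0 M X Y : full M -> rep_iso M (rep_sum X Y) ->
  d1 X = 0%N -> d2 X = 0%N.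
Proof.
move=> fM [f [[i1 i2] [s1 s2]]] X0.
have X10 (x : rep1 X) : x = 0.
  have /eqP f0 : fullv == (0%VS : {vspace rep1 X}) by rewrite -dimv_eq0 -/(d1 X) X0.
  by apply/eqP; rewrite -memv0 -f0 memvf.
have h : forall v, (hom2 f v).1 = 0.
  apply: (fullP fM) => [|u v|j m]; first by rewrite linear0.
    by rewrite linearD /= => -> ->; rewrite addr0.
  by rewrite khomE gam_sumE /= (X10 (_).1) linear0.
apply/eqP; rewrite /d2 dimv_eq0 -subv0; apply/subvP => x _.
by have [v e] := limg_surj (x, 0) s2; have := h v; rewrite -e /= => ->; apply: mem0v.
Qed.

Lemma faithful_d1_le M : faithful M -> d2 M = 0%N -> d1 M = 0%N.
Proof.
rewrite /d1 /d2 => fM M0; apply/eqP; rewrite dimv_eq0 -subv0; apply/subvP => m _.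
rewrite memv0; apply/eqP/fM => j; apply/eqP; rewrite -memv0.
by move/eqP: M0; rewrite dimv_eq0 => /eqP <-; apply: memvf.
Qed.

(** Both conditions pass to an indecomposable summand X, so X_1 and X_2 are nonzero; their
    dimensions are at most r - 1, and no power of the translation kills X. *)
Lemma reduced_regular M : (3 <= r)%N -> (d1 M <= r.-1)%N -> (d2 M <= r.-1)%N ->
  full M -> faithful M -> regular M.
Proof.
move=> r3 h1 h2 fuM faM X iX [Y iso]; split=> // t.
have [e1 e2] := rep_iso_dim iso; have [s1 s2] := dim_rep_sum X Y.
have faX := summand_faithful faM iso; have X0 := summand_d1_eq0 fuM iso.
have d1X : (0 < d1 X)%N.
  by rewrite lt0n; apply/eqP => X10; apply: (iX.1); split; last exact: X0.
have d2X : (0 < d2 X)%N.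
  by rewrite lt0n; apply/eqP => X20; move: d1X; rewrite faithful_d1_le.
apply: tau_pow_neq0 => //; first by apply: leq_trans h1; rewrite e1 s1 leq_addr.
by apply: leq_trans h2; rewrite e2 s2 leq_addr.
Qed.

End Regularity.

(** * Regular modules have no simple summands *)

Section Elementary.
Local Open Scope ring_scope.
Variables (k : fieldType) (r : nat).
Implicit Types M N X Y L : krep k r.

Lemma separating_form (V : vectType k) (U : {vspace V}) w : w \notin U ->
  exists2 phi : 'Hom(V, k^o), phi w = 1 & forall u, u \in U -> phi u = 0.
Proof.
move=> wU; pose p v := v - projv U v; pose R := coord (vbasis {: V}).
have [i Ri] : exists i, R i (p w) != 0.
  apply: contrapT => /forallNP h; move/negP: wU; apply.
  have /subr0_eq -> : p w = 0.
    rewrite (coord_vbasis (memvf (p w))) big1 // => i _.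
    by have /negP/negPn/eqP := h i; rewrite /R => ->; rewrite scale0r.
  exact: memv_proj.
pose f v : k^o := (R i (p w))^-1 * R i (p v).
have fL : linear f.
  move=> c u v; rewrite /f /p /R linearP /= opprD addrACA -scalerBr linearP mulrDr.
  by rewrite mulrCA.
exists (linfun f); first by rewrite linfunE // /f mulVf.
by move=> u uU; rewrite linfunE // /f /p (projv_id uU) subrr /R linear0 mulr0.
Qed.

Lemma dims1_indecomposable X : (d1 X + d2 X = 1)%N -> indecomposable X.
Proof.
move=> h; split; first by rewrite /d1 /d2 in h => -[]; move: h => /[swap] -> /[swap] ->.
move=> Y Z /rep_iso_dim[]; have [-> ->] := dim_rep_sum Y Z => e1 e2.
have [//|e] : (d1 Y + d2 Y = 0 \/ d1 Z + d2 Z = 0)%N by lia.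
  by left; rewrite /rep_zero /has_dimvec -/(d1 Y) -/(d2 Y); lia.
by right; rewrite /rep_zero /has_dimvec -/(d1 Z) -/(d2 Z); lia.
Qed.

Lemma memv_sub_form (V : vectType k) (phi : 'Hom(V, k^o)) w v :
  phi w = 1 -> v - phi v *: w \in lker phi.
Proof.
by move=> pw; rewrite memv_ker linearB linearZ /= pw [_ *: _]mulr1 subrr.
Qed.

(** When phi w = 1, this map is the splitting of V into the line of w and the kernel of phi. *)
Lemma linear_form_split (V : vectType k) (phi : 'Hom(V, k^o)) w :
  linear (fun v => (phi v, vsproj (lker phi) (v - phi v *: w))).
Proof.
move=> c u v; rewrite !linearP; congr (_, _); rewrite /= -[RHS]linearP.
congr (vsproj _ _).
by rewrite scalerBr addrACA -opprD scalerDl !scalerA.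
Qed.

Lemma dim_lker_form (V : vectType k) (phi : 'Hom(V, k^o)) w :
  phi w = 1 -> \dim {: V} = (1 + \dim (lker phi))%N.
Proof.
move=> pw; rewrite -(limg_ker_dim phi fullv) capfv addnC; congr (_ + _)%N.
apply/eqP; rewrite eqn_leq; apply/andP; split.
  by apply: leq_trans (dimvS (subvf _)) _; rewrite dim_ko.
rewrite lt0n dimv_eq0; apply/eqP => l0.
have : phi w \in limg phi by rewrite memv_img ?memvf.
by rewrite l0 memv0 pw oner_eq0.
Qed.

Lemma subvs_proj_eq0 (V : vectType k) (U : {vspace V}) v :
  v \in U -> vsproj U v = 0 -> v = 0.
Proof. by move=> vU h; rewrite -(vsprojK vU) h. Qed.

(** A vector w outside the span U of the images splits off: with phi vanishing on U and phi w = 1, M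
    is the sum of (0, k) and (M_1, ker phi), and (0, k) is not regular. *)
Lemma regular_full M : regular M -> full M.
Proof.
move=> regM; apply: contrapT => nf; rewrite /full in nf; set U := (\sum_j _)%VS in nf.
have [w wU] : exists w, w \notin U.
  apply: contrapT => /forallNP h; apply: nf; apply/vspaceP => w.
  by rewrite memvf; apply/negPn/negP/h.
have [phi pw pU] := separating_form wU; pose H := lker phi.
pose X := @KRep k r 'rV[k]_0 k^o (fun=> 0).
pose Y := @KRep k r (rep1 M) (subvs_of H) (fun j => (linfun (vsproj H) \o gam M j)%VF).
pose f1 : 'Hom(rep1 M, rep1 (rep_sum X Y)) :=
  linfun (fun m : rep1 M => (0 : 'rV[k]_0, m)).
have f1E m : f1 m = (0, m).
  by rewrite /f1 linfunE // => c u v; congr (_, _); rewrite /= scaler0 addr0.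
pose f2 : 'Hom(rep2 M, rep2 (rep_sum X Y)) :=
  linfun (fun v : rep2 M => (phi v, vsproj H (v - phi v *: w))).
have vH v : v - phi v *: w \in H by apply: memv_sub_form.
have f2E v : f2 v = (phi v, vsproj H (v - phi v *: w)).
  by rewrite /f2 linfunE //; apply: linear_form_split.
have com j : (f2 \o gam M j = gam (rep_sum X Y) j \o f1)%VF.
  apply/lfunP => m; rewrite !comp_lfunE f1E gam_sumE f2E /= comp_lfunE lfunE /=.
  have jU : (limg (gam M j) <= U)%VS by exact: (sumv_sup j).
  have mU : gam M j m \in U by apply: (subvP jU); rewrite memv_img ?memvf.
  by rewrite (pU _ mU) scale0r subr0 lfunE.
have iX : indecomposable X.
  by apply: dims1_indecomposable; rewrite /d1 /d2 dim_rV dim_ko.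
have : direct_summand X M.
  exists Y; apply: (@khom_rep_iso _ _ _ _ (KHom com)).
  - split; apply: lker0I => u /=; first by rewrite f1E => -[].
    rewrite f2E => -[pu0] /(subvs_proj_eq0 (vH u)).
    by rewrite pu0 scale0r subr0.
  - by rewrite (dim_rep_sum X Y).1 /d1 /= dim_rV.
  by rewrite (dim_rep_sum X Y).2 /d2 /= dim_ko dim_subvs (dim_lker_form pw).
by move=> /(regM X iX)/regular_indec_d1; rewrite /d1 dim_rV.
Qed.

(** Dually, a nonzero m killed by all arrows splits off (k, 0), with complement (ker phi, M_2) for a
    form phi with phi m = 1. *)
Lemma regular_faithful M : regular M -> faithful M.
Proof.
move=> regM m hm; apply: contrapT => m0.
have mU : m \notin (0%VS : {vspace rep1 M}) by rewrite memv0; apply/eqP.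
have [phi pm _] := separating_form mU; pose H := lker phi.
pose X := @KRep k r k^o 'rV[k]_0 (fun=> 0).
pose Y := @KRep k r (subvs_of H) (rep2 M) (fun j => (gam M j \o linfun vsval)%VF).
pose f1 : 'Hom(rep1 M, rep1 (rep_sum X Y)) :=
  linfun (fun v : rep1 M => (phi v, vsproj H (v - phi v *: m))).
pose f2 : 'Hom(rep2 M, rep2 (rep_sum X Y)) :=
  linfun (fun v : rep2 M => (0 : 'rV[k]_0, v)).
have vH v : v - phi v *: m \in H by apply: memv_sub_form.
have f1E v : f1 v = (phi v, vsproj H (v - phi v *: m)).
  by rewrite /f1 linfunE //; apply: linear_form_split.
have f2E v : f2 v = (0, v).
  by rewrite /f2 linfunE // => c u v'; congr (_, _); rewrite /= scaler0 addr0.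
have com j : (f2 \o gam M j = gam (rep_sum X Y) j \o f1)%VF.
  have iotaE u : linfun (vsval : subvs_of H -> _) u = vsval u by rewrite lfunE.
  apply/lfunP => v; rewrite !comp_lfunE f1E gam_sumE f2E; congr (_, _).
    by rewrite zero_lfunE.
  by rewrite comp_lfunE iotaE vsprojK // linearB linearZ /= hm scaler0 subr0.
have iX : indecomposable X.
  by apply: dims1_indecomposable; rewrite /d1 /d2 dim_rV dim_ko.
have : direct_summand X M.
  exists Y; apply: (@khom_rep_iso _ _ _ _ (KHom com)).
  - split; apply: lker0I => u /=; last by rewrite f2E => -[].
    rewrite f1E => -[pu0] /(subvs_proj_eq0 (vH u)).
    by rewrite pu0 scale0r subr0.
  - by rewrite (dim_rep_sum X Y).1 /d1 /= dim_ko dim_subvs (dim_lker_form pm).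
  by rewrite (dim_rep_sum X Y).2 /d2 /= dim_rV.
by move=> /(regM X iX)/regular_indec_d2; rewrite /d2 dim_rV.
Qed.

End Elementary.

(** * Subrepresentations and quotients *)

Section Quotient.
Local Open Scope ring_scope.
Variables (k : fieldType) (V : vectType k) (U : {vspace V}).

Definition incl : 'Hom(subvs_of U, V) := linfun vsval.
(** The quotient V / U is realised on the complement of U, so that it is again a [vectType]. *)
Definition quo : 'Hom(V, subvs_of U^C) := (linfun (vsproj U^C) \o (\1 - projv U))%VF.

Lemma inclE u : incl u = vsval u. Proof. by rewrite lfunE. Qed.

Lemma quoE v : vsval (quo v) = v - projv U v.
Proof.
rewrite comp_lfunE [linfun _ _]lfunE /= add_lfunE opp_lfunE id_lfunE vsprojK //.
exact: memv_projC.
Qed.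

Lemma quo_eq0 v : (quo v == 0) = (v \in U).
Proof.
rewrite -(inj_eq val_inj) /= quoE subr_eq0; apply/eqP/idP => [->|/projv_id ->//].
exact: memv_proj.
Qed.

Lemma lker_quo : lker quo = U.
Proof. by apply/vspaceP => v; rewrite memv_ker quo_eq0. Qed.

Lemma limg_quo : limg quo = fullv.
Proof.
apply/eqP; rewrite eqEdim subvf /= dim_subvs dimv_compl.
by rewrite -(limg_ker_dim quo fullv) capfv lker_quo addKn.
Qed.

Lemma quo_repr v : quo (vsval (quo v)) = quo v.
Proof.
apply/eqP; rewrite -subr_eq0 -linearB quo_eq0 quoE addrAC subrr add0r rpredN.
exact: memv_proj.
Qed.

Lemma lker_incl : lker incl = 0%VS.
Proof. by apply: lker0I => u; rewrite inclE => u0; apply: val_inj. Qed.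

Lemma limg_incl : limg incl = U.
Proof.
apply/vspaceP => v; apply/memv_imgP/idP => [[u _ ->]|vU]; first by rewrite inclE subvsP.
by exists (vsproj U v); rewrite ?memvf // inclE vsprojK.
Qed.

End Quotient.

Section SubQuotient.
Local Open Scope ring_scope.
Variables (k : fieldType) (r : nat) (M : krep k r).
Variables (U1 : {vspace rep1 M}) (U2 : {vspace rep2 M}).

(** [subrep] and [quorep] are defined for any pair of subspaces by means of projections; the
    stability assumed below gives them their meaning. *)
Definition subrep : krep k r :=
  @KRep k r (subvs_of U1) (subvs_of U2)
    (fun j => linfun (vsproj U2) \o gam M j \o incl U1)%VF.

Definition quorep : krep k r :=
  @KRep k r (subvs_of U1^C) (subvs_of U2^C)
    (fun j => quo U2 \o gam M j \o incl U1^C)%VF.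

Hypothesis stable : forall j m, m \in U1 -> gam M j m \in U2.

Lemma subrepE j (m : rep1 subrep) :
  vsval (gam subrep j m : subvs_of U2) = gam M j (vsval m).
Proof. by rewrite !comp_lfunE inclE [linfun _ _]lfunE /= vsprojK // stable // subvsP. Qed.

Lemma quorepE j m : gam quorep j (quo U1 m) = quo U2 (gam M j m).
Proof.
transitivity (quo U2 (gam M j (vsval (quo U1 m)))).
  by rewrite !comp_lfunE inclE.
apply/eqP; rewrite -subr_eq0 -(linearB (quo U2)) quo_eq0 -linearB.
by apply: stable; rewrite -quo_eq0 (linearB (quo U1)) subr_eq0; apply/eqP/quo_repr.
Qed.

Lemma sub_quo_exact : short_exact subrep M quorep.
Proof.
have comI j : (incl U2 \o gam subrep j = gam M j \o incl U1)%VF.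
  by apply/lfunP => m; rewrite comp_lfunE inclE subrepE comp_lfunE inclE.
have comQ j : (quo U2 \o gam M j = gam quorep j \o quo U1)%VF.
  by apply/lfunP => m; rewrite comp_lfunE [RHS]comp_lfunE quorepE.
exists (@KHom _ _ subrep M (incl U1) (incl U2) comI),
  (@KHom _ _ M quorep (quo U1) (quo U2) comQ); split; split=> /=.
- exact: lker_incl.
- exact: lker_incl.
- by rewrite limg_incl lker_quo.
- by rewrite limg_incl lker_quo.
- exact: limg_quo.
- exact: limg_quo.
Qed.

Lemma d_subrep : d1 subrep = \dim U1 /\ d2 subrep = \dim U2.
Proof. by rewrite /d1 /d2 !dim_subvs. Qed.

Lemma d_quorep : d1 quorep = (d1 M - \dim U1)%N /\ d2 quorep = (d2 M - \dim U2)%N.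
Proof. by rewrite /d1 /d2 !dim_subvs !dimv_compl !dimvf. Qed.

Lemma quorep_full : full M -> full quorep.
Proof.
move=> fM; rewrite /full; apply/vspaceP => v; rewrite memvf.
have [w ->] := limg_surj v (limg_quo U2).
move: w; apply: (fullP fM) => [|u w|j m]; first by rewrite linear0 mem0v.
  by rewrite linearD; apply: memvD.
rewrite -quorepE; apply: (subvP (_ : (limg (gam quorep j) <= _)%VS)).
  exact: (sumv_sup j).
by rewrite memv_img ?memvf.
Qed.

Lemma subrep_faithful : faithful M -> faithful subrep.
Proof.
move=> fM m hm; apply: val_inj; apply: fM => j.
by rewrite -subrepE hm.
Qed.

End SubQuotient.

(** * Elementary modules are those generated by each nonzero vector *)

Section ElementaryGenerated.
Local Open Scope ring_scope.
Variables (k : fieldType) (r : nat).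
Implicit Types M N L : krep k r.

Definition generated M : Prop :=
  forall m, m != 0 -> (\sum_j <[gam M j m]>)%VS = fullv.

Lemma generated_faithful M : (0 < d2 M)%N -> generated M -> faithful M.
Proof.
move=> M2 gM m hm; apply/eqP; apply: contraLR M2 => /gM h.
rewrite /d2 -h big1 ?dimv0 // => j _.
by rewrite hm; apply/eqP; rewrite -subv0 -memvE mem0v.
Qed.

Lemma generated_full M : (0 < d1 M)%N -> generated M -> full M.
Proof.
move=> M1 gM; rewrite /full; set m := vpick {: rep1 M}.
have m0 : m != 0 by rewrite vpick0 -dimv_eq0 -lt0n.
apply/eqP; rewrite eqEsubv subvf -(gM m m0); apply/subv_sumP => j _.
apply: subv_trans (_ : limg (gam M j) <= _)%VS; last exact: (sumv_sup j).
by rewrite -memvE memv_img ?memvf.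
Qed.

(** A regular L != 0 inside M has L_1 != 0, because L_1 generates L_2. Hence L_2 = M_2 and N_2 = 0,
    and faithfulness of the regular quotient N forces N = 0. *)
Lemma generated_elementary M : (3 <= r)%N -> (0 < d1 M <= r.-1)%N ->
  (0 < d2 M <= r.-1)%N -> generated M -> elementary M.
Proof.
move=> r3 /andP[a0 ar] /andP[b0 br] gM.
have faM := generated_faithful b0 gM; have fuM := generated_full a0 gM.
split; first by case=> h _; move: a0; rewrite /d1 h.
  exact: reduced_regular.
move=> [L [N [L0 regL N0 regN [f [g [[i1 i2] [e1 e2] [s1 s2]]]]]]].
have [l l0] : exists l : rep1 L, l != 0.
  apply: contrapT => /forallNP h; have l0 (l : rep1 L) : l = 0.
    by have /negP/negPn/eqP := h l.
  apply: L0; split; apply/eqP; rewrite dimv_eq0 -subv0; apply/subvP => v _.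
    by rewrite (l0 v) mem0v.
  rewrite memv0; apply/eqP; move: v; apply: (fullP (regular_full regL)) => //.
    by move=> u v -> ->; rewrite addr0.
  by move=> j m; rewrite (l0 m) linear0.
have fl0 : hom1 f l != 0 by apply: contra l0 => /eqP h; apply/eqP/(lker_inj i1).
have f2full : limg (hom2 f) = fullv.
  apply/eqP; rewrite eqEsubv subvf -(gM _ fl0); apply/subv_sumP => j _.
  by rewrite -memvE -khomE memv_img ?memvf.
have N20 (v : rep2 N) : v = 0.
  have [u ->] := limg_surj v s2; apply/eqP.
  by rewrite -memv_ker -e2 f2full memvf.
apply: N0; split; apply/eqP; rewrite dimv_eq0 -subv0; apply/subvP => v _.
  by rewrite memv0; apply/eqP/(regular_faithful regN) => j; apply: N20.
by rewrite (N20 v) mem0v.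
Qed.

Lemma elementary_generated M : (3 <= r)%N -> (d1 M <= r.-1)%N ->
  (d2 M <= r.-1)%N -> elementary M -> generated M.
Proof.
move=> r3 ar br [_ regM noext] m m0; apply: contrapT; set U := (\sum_j _)%VS => nU.
have faM := regular_faithful regM; have fuM := regular_full regM.
(* The largest choice of U1 makes the quotient faithful; the submodule is full because m, which
   spans U under the arrows, lies in U1. *)
pose U1 := (\bigcap_j (gam M j @^-1: U))%VS.
have U1P v : reflect (forall j, gam M j v \in U) (v \in U1).
  apply: (iffP idP) => [vU j|h].
    rewrite memv_preim; apply: (subvP _ _ vU); exact: (bigcapv_inf j).
  apply/(subvP (_ : <[v]> <= U1)%VS)/memv_line/subv_bigcapP => j _.
  by rewrite -memvE -memv_preim h.
have st j v : v \in U1 -> gam M j v \in U by move=> /U1P.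
have genU j : gam M j m \in U.
  apply: (subvP (_ : (<[gam M j m]> <= U)%VS)); last exact: memv_line.
  exact: (sumv_sup j).
have mU1 : m \in U1 by apply/U1P.
have [qs1 qs2] := d_quorep U1 U; have [ss1 ss2] := d_subrep U1 U.
apply: noext; exists (subrep U1 U), (quorep U1 U); split.
- case=> h _; have : m \in (0%VS : {vspace rep1 M}); last by rewrite memv0; apply/negP.
  have -> : 0%VS = U1 by apply/esym/eqP; rewrite -dimv_eq0 -ss1 /d1 h.
  exact: mU1.
- apply: reduced_regular => //; last exact: subrep_faithful.
  + by rewrite ss1; apply: leq_trans ar; rewrite dimvS ?subvf.
  + by rewrite ss2; apply: leq_trans br; rewrite dimvS ?subvf.
  rewrite /full; apply/vspaceP => u; rewrite memvf.
  have /memv_sumP[w hw uE] := subvsP u.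
  have -> : u = \sum_j vsproj U (w j).
    by rewrite -[u]vsvalK uE linear_sum.
  apply: memv_sumr => j _; have /vlineP[c ->] := hw j isT.
  apply/memv_imgP; exists (c *: vsproj U1 m); rewrite ?memvf //.
  apply: val_inj; transitivity (gam M j (vsval (c *: vsproj U1 m))); last first.
    by apply/esym/subrepE.
  by rewrite [vsval _]linearZ linearZ /= !vsprojK ?memvZ // linearZ.
- case=> _ h; apply: nU; apply/eqP; rewrite eqEdim subvf /= -subn_eq0.
  by rewrite -/(d2 M) -qs2 /d2 h.
- apply: reduced_regular => //; last 2 first.
  + exact: quorep_full.
  + move=> v hv; have [w wE] := limg_surj v (limg_quo U1).
    rewrite wE; apply/eqP; rewrite quo_eq0; apply/U1P => j; rewrite -quo_eq0.
    by rewrite -(quorepE st) -wE hv.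
  + by rewrite qs1; apply: leq_trans ar; apply: leq_subr.
  by rewrite qs2; apply: leq_trans br; apply: leq_subr.
exact: sub_quo_exact.
Qed.

End ElementaryGenerated.

(** * Bijections of classes induced by a relation *)

Section Classes.

Definition class_of T (R : T -> T -> Prop) (A : T -> Prop) a : T -> Prop :=
  fun b => A b /\ R a b.

(** The correspondence is a relation, since it depends on a choice of coordinates; the image of a
    class is closed up under R2. *)
Definition class_image T1 T2 (A2 : T2 -> Prop) (R2 : T2 -> T2 -> Prop)
    (corr : T1 -> T2 -> Prop) (C : T1 -> Prop) : T2 -> Prop :=
  fun b => A2 b /\ exists a b0, [/\ C a, A2 b0, corr a b0 & R2 b0 b].

Lemma class_imageE T1 T2 (A1 : T1 -> Prop) (A2 : T2 -> Prop) R1 R2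
    (corr : T1 -> T2 -> Prop) :
  (forall a, R1 a a) -> (forall b c d, R2 b c -> R2 c d -> R2 b d) ->
  (forall a a' b b', A1 a -> A1 a' -> A2 b -> A2 b' -> corr a b -> corr a' b' ->
    R1 a a' -> R2 b b') ->
  forall a b, A1 a -> A2 b -> corr a b ->
  class_image A2 R2 corr (class_of R1 A1 a) = class_of R2 A2 b.
Proof.
move=> refl trans compat a b Aa Ab cab; apply/funext => c; apply/propext; split.
  move=> [Ac [a' [b' [[Aa' aa'] Ab' ca'b' b'c]]]]; split=> //.
  by apply: trans b'c; apply: compat cab ca'b' aa'.
by move=> [Ac bc]; split=> //; exists a, b.
Qed.

(** The image of a class is the class of any correspondent of a representative; the inverse map is
    the same construction for the reversed relation. *)
Lemma classes_bijection T1 T2 (A1 : T1 -> Prop) (A2 : T2 -> Prop) R1 R2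
    (corr : T1 -> T2 -> Prop) :
  (forall a, R1 a a) -> (forall a b c, R1 a b -> R1 b c -> R1 a c) ->
  (forall a, R2 a a) -> (forall a b c, R2 a b -> R2 b c -> R2 a c) ->
  (forall a, A1 a -> exists2 b, A2 b & corr a b) ->
  (forall b, A2 b -> exists2 a, A1 a & corr a b) ->
  (forall a a' b b', A1 a -> A1 a' -> A2 b -> A2 b' -> corr a b -> corr a' b' ->
    R1 a a' <-> R2 b b') ->
  exists Phi : classes R1 A1 -> classes R2 A2, bijective Phi.
Proof.
move=> refl1 trans1 refl2 trans2 tot1 tot2 compat.
pose rcorr b a := corr a b.
have imE := class_imageE refl1 trans2
  (fun a a' b b' Aa Aa' Ab Ab' c c' => (compat a a' b b' Aa Aa' Ab Ab' c c').1).
have imE' a b : A2 b -> A1 a -> corr a b ->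
    class_image A1 R1 rcorr (class_of R2 A2 b) = class_of R1 A1 a.
  move=> Ab Aa c; apply: class_imageE => // b1 b2 a1 a2 h1 h2 h3 h4 h5 h6.
  exact: (compat a1 a2 b1 b2 h3 h4 h1 h2 h5 h6).2.
have Phi_sub (C : classes R1 A1) :
    exists2 b, A2 b & class_image A2 R2 corr (sval C) = class_of R2 A2 b.
  case: C => _ /= [a Aa ->]; have [b Ab cab] := tot1 a Aa.
  by exists b => //; apply: imE.
have Psi_sub (C : classes R2 A2) :
    exists2 a, A1 a & class_image A1 R1 rcorr (sval C) = class_of R1 A1 a.
  case: C => _ /= [b Ab ->]; have [a Aa cab] := tot2 b Ab.
  by exists a => //; apply: imE'.
have sig_inj T (P : T -> Prop) (u v : {x | P x}) : sval u = sval v -> u = v.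
  case: u v => [u hu] [v hv] /= e; subst v; congr (exist _ _ _).
  exact: Prop_irrelevance.
pose P2 C := exists2 b, A2 b & C = class_of R2 A2 b.
pose P1 C := exists2 a, A1 a & C = class_of R1 A1 a.
exists (fun C => exist P2 _ (Phi_sub C)).
exists (fun C => exist P1 _ (Psi_sub C)) => -[C [a Aa Ca]]; apply: sig_inj => /=.
  rewrite Ca; have [b Ab cab] := tot1 a Aa.
  by rewrite -/(class_of R1 A1 a) (imE _ b) // (imE' a).
rewrite Ca; have [b Ab cab] := tot2 a Aa.
by rewrite -/(class_of R2 A2 a) (imE' b) // (imE _ a).
Qed.

End Classes.

(** * Reflexivity and transitivity of the two isomorphism relations *)

Section Equivalences.
Local Open Scope ring_scope.

Lemma rep_iso_refl (k : fieldType) r (M : krep k r) : rep_iso M M.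
Proof.
have com j : (\1 \o gam M j = gam M j \o \1)%VF by rewrite comp_lfun1l comp_lfun1r.
apply: (@khom_rep_iso _ _ _ _ (KHom com)) => //.
by split; apply: lker0I => u /=; rewrite id_lfunE.
Qed.

Lemma rep_iso_trans (k : fieldType) r (M N P : krep k r) :
  rep_iso M N -> rep_iso N P -> rep_iso M P.
Proof.
move=> iMN iNP; have [e1 e2] := rep_iso_dim iMN; have [e3 e4] := rep_iso_dim iNP.
case: iMN => f [[f1 f2] _]; case: iNP => g [[g1 g2] _].
have com j : ((hom2 g \o hom2 f) \o gam M j = gam P j \o (hom1 g \o hom1 f))%VF.
  by apply/lfunP => m; rewrite !comp_lfunE !khomE.
apply: (@khom_rep_iso _ _ _ _ (KHom com)); rewrite ?e1 ?e2 //.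
by split; apply: lker0I => u /=; rewrite comp_lfunE => /lker_inj h; apply: lker_inj (h _).
Qed.

Lemma subspace_iso_refl (k : fieldType) j i (H : {vspace lin_maps k j i}) :
  subspace_iso H H.
Proof.
exists \1%VF; first by apply: lker0I => u; rewrite id_lfunE.
move=> w; split=> [wH|[v vH ->]]; last by rewrite comp_lfun1r.
by exists w; rewrite ?comp_lfun1r.
Qed.

Lemma subspace_iso_trans (k : fieldType) j i (H1 H2 H3 : {vspace lin_maps k j i}) :
  subspace_iso H1 H2 -> subspace_iso H2 H3 -> subspace_iso H1 H3.
Proof.
move=> [g g0 hg] [h h0 hh]; exists (g \o h)%VF.
  by apply: lker0I => u; rewrite comp_lfunE => /(lker_inj g0)/(lker_inj h0).
move=> w; split=> [/hh[v /hg[u uH ->] ->]|[v vH ->]].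
  by exists u; rewrite // comp_lfunA.
by rewrite comp_lfunA; apply/hh; exists (v \o g)%VF => //; apply/hg; exists v.
Qed.

End Equivalences.

(** * Modules as spaces of linear maps *)

Section Slices.
Local Open Scope ring_scope.
Variables (k : fieldType) (y r : nat).
Implicit Types M N : krep k r.

Definition dot (w u : 'rV[k]_y) : k := (w *m u^T) 0 0.

Lemma dotDr w c u v : dot w (c *: u + v) = c * dot w u + dot w v.
Proof. by rewrite /dot linearP /= mulmxDr -scalemxAr !mxE. Qed.

Lemma dotDl u c w v : dot (c *: w + v) u = c * dot w u + dot v u.
Proof. by rewrite /dot mulmxDl -scalemxAl !mxE. Qed.

Lemma dotC w u : dot w u = dot u w.
Proof. by rewrite /dot -[LHS]/((w *m u^T) 0 0) -[w *m _]trmxK trmx_mul trmxK mxE. Qed.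

Lemma dot_mulmx w u (B : 'M[k]_y) : dot w (u *m B) = dot (w *m B^T) u.
Proof. by rewrite /dot trmx_mul mulmxA. Qed.

Lemma dot_delta w i : dot w (delta_mx 0 i) = w 0 i.
Proof. by rewrite /dot trmx_delta -colE mxE. Qed.

Lemma dot_eq0 w : (forall u, dot w u = 0) -> w = 0.
Proof. by move=> h; apply/rowP => i; rewrite mxE -dot_delta h. Qed.

(** A module is a tensor in M_1^* (x) M_2 (x) k^r. Coordinates e on M_2 identify its dual with k^y
    through [dot], so that m becomes a map k^y -> k^r. *)
Definition slice_fun M (e : 'Hom(rep2 M, 'rV[k]_y)) (m : rep1 M) : lin_maps k y r :=
  linfun (fun w : 'rV[k]_y => \row_j dot w (e (gam M j m))).

Definition slice M (e : 'Hom(rep2 M, 'rV[k]_y)) : 'Hom(rep1 M, lin_maps k y r) :=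
  linfun (slice_fun e).

Lemma slice_funE M (e : 'Hom(rep2 M, 'rV[k]_y)) m w :
  slice_fun e m w = \row_j dot w (e (gam M j m)).
Proof. by rewrite linfunE // => c u v; apply/rowP => j; rewrite !mxE dotDl. Qed.

Lemma sliceE M (e : 'Hom(rep2 M, 'rV[k]_y)) m w :
  slice e m w = \row_j dot w (e (gam M j m)).
Proof.
rewrite linfunE ?slice_funE // => c u v; apply/lfunP => w'.
rewrite add_lfunE scale_lfunE !slice_funE; apply/rowP => j.
by rewrite !mxE !linearP dotDr.
Qed.

(** A vector w in the kernel is orthogonal to all e (gam M j m), which span k^y. *)
Lemma slice_generated M (e : 'Hom(rep2 M, 'rV[k]_y)) : limg e = fullv ->
  generated M -> forall m, m != 0 -> lker (slice e m) = 0%VS.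
Proof.
move=> se gM m m0; apply: lker0I => w; rewrite sliceE => /rowP h.
apply: dot_eq0 => u; have [v ->] := limg_surj u se.
have := memvf v; rewrite -(gM m m0) => /memv_sumP[z hz ->].
rewrite linear_sum; elim/big_rec: _ => [|j a _ IH].
  by rewrite /dot trmx0 mulmx0 mxE.
have /vlineP[c ->] := hz j isT.
by rewrite linearZ dotDr IH addr0; have := h j; rewrite !mxE => ->; rewrite mulr0.
Qed.

Lemma generated_slice M (e : 'Hom(rep2 M, 'rV[k]_y)) : lker e = 0%VS -> d2 M = y ->
  (forall m, m != 0 -> lker (slice e m) = 0%VS) -> generated M.
Proof.
move=> e0 dM h m m0; apply: contrapT; set U := (\sum_j _)%VS => nU.
have se : limg e = fullv by apply: lker0_limg; rewrite // dim_rV.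
have [v vU] : exists v, v \notin U.
  apply: contrapT => /forallNP nv; apply: nU; apply/vspaceP => v.
  by rewrite memvf; apply/negPn/negP/nv.
have [phi phiv phiU] := separating_form vU.
(* The vector representing phi under [dot] in the coordinates e; it lies in the kernel of the slice
   of m because phi vanishes on U. *)
pose w : 'rV[k]_y := \row_i phi ((e^-1)%VF (delta_mx 0 i)).
have wE u : dot w (e u) = phi u.
  rewrite -{2}[u](lker0_lfunK (f := e)) ?e0 // [e u in RHS]row_sum_delta.
  rewrite !linear_sum /dot mxE; apply: eq_bigr => i _.
  by rewrite !linearZ !mxE mulrC.
have w0 : w = 0.
  apply: (lker_inj (h m m0)); rewrite sliceE; apply/rowP => j; rewrite !mxE wE phiU //.
  apply: (subvP (_ : (<[gam M j m]> <= U)%VS)); last exact: memv_line.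
  exact: (sumv_sup j).
by move: (wE v); rewrite w0 phiv /dot mul0mx mxE => /esym/eqP; rewrite oner_eq0.
Qed.

Definition corresponds M (H : {vspace lin_maps k y r}) : Prop :=
  exists2 e : 'Hom(rep2 M, 'rV[k]_y), lker e = 0%VS & H = limg (slice e).

End Slices.

(** * Isomorphic modules and isomorphic subspaces *)

Section Correspondence.
Local Open Scope ring_scope.
Variables (k : fieldType) (y r : nat).
Implicit Types (M : krep k r) (H : {vspace lin_maps k y r}).

Lemma dot_inj (u v : 'rV[k]_y) : (forall w, dot w u = dot w v) -> u = v.
Proof.
move=> h; apply/rowP => i; have := h (delta_mx 0 i).
by rewrite dotC dot_delta dotC dot_delta.
Qed.

Lemma mulmx_lin1 (A : 'End('rV[k]_y)) u : u *m lin1_mx A = A u.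
Proof. exact: mul_rV_lin1. Qed.

Lemma slice_lker0 M (e : 'Hom(rep2 M, 'rV[k]_y)) : (0 < y)%N ->
  limg e = fullv -> generated M -> lker (slice e) = 0%VS.
Proof.
move=> y0 se gM; apply: lker0I => m sm; apply/eqP/negPn/negP => m0.
have := slice_generated se gM m0; rewrite sm => l0.
have : const_mx 1 \in lker (0 : lin_maps k y r) by rewrite memv_ker zero_lfunE.
rewrite l0 memv0 => /eqP/rowP/(_ (Ordinal y0)); rewrite !mxE => /eqP.
by rewrite oner_eq0.
Qed.

(** In coordinates, the component of the isomorphism at vertex 2 is a matrix A; moved across [dot],
    its transpose g turns the slice of m into that of its image. *)
Lemma corresponds_rep_iso M M' H H' : d2 M = y -> d2 M' = y ->
  corresponds M H -> corresponds M' H' -> rep_iso M M' -> subspace_iso H H'.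
Proof.
move=> dM dM' [e e0 ->] [e' e'0 ->] [f [[i1 i2] [s1 s2]]].
have se : limg e = fullv by apply: lker0_limg; rewrite // dim_rV.
have se' : limg e' = fullv by apply: lker0_limg; rewrite // dim_rV.
pose A : 'End('rV[k]_y) := (e' \o hom2 f \o e^-1)%VF.
have AE v : A (e v) = e' (hom2 f v) by rewrite !comp_lfunE lker0_lfunK ?e0.
pose g : 'End('rV[k]_y) := linfun (mulmxr (lin1_mx A)^T).
have gE w : g w = w *m (lin1_mx A)^T by rewrite lfunE.
have sl m : slice e' (hom1 f m) = (slice e m \o g)%VF.
  apply/lfunP => w; rewrite comp_lfunE !sliceE; apply/rowP => j; rewrite !mxE.
  by rewrite -khomE -AE -mulmx_lin1 dot_mulmx gE.
exists g.
  apply: lker0I => w gw0; apply: dot_eq0 => u.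
  have [v' ->] := limg_surj u se'; have [v ->] := limg_surj v' s2.
  by rewrite -AE -mulmx_lin1 dot_mulmx -gE gw0 /dot mul0mx mxE.
move=> w; split=> [/memv_imgP[m' _ ->]|[_ /memv_imgP[m _ ->] ->]].
  have [m ->] := limg_surj m' s1.
  by exists (slice e m); rewrite ?sl // memv_img ?memvf.
by rewrite -sl memv_img ?memvf.
Qed.

Lemma corresponds_subspace_iso M M' H H' : (0 < y)%N -> d1 M = d1 M' ->
  d2 M = y -> d2 M' = y -> generated M ->
  corresponds M H -> corresponds M' H' -> subspace_iso H H' -> rep_iso M M'.
Proof.
move=> y0 d1E dM dM' gM [e e0 ->] [e' e'0 ->] [g g0 hg].
have se : limg e = fullv by apply: lker0_limg; rewrite // dim_rV.
have se' : limg e' = fullv by apply: lker0_limg; rewrite // dim_rV.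
have sg : limg g = fullv by apply: lker0_limg.
pose pre : 'Hom(lin_maps k y r, lin_maps k y r) :=
  linfun (fun v : lin_maps k y r => (v \o g)%VF).
have preE v : pre v = (v \o g)%VF by rewrite linfunE //; apply: linear_comp_lfun.
(* The inverse is meaningful only on the image of [slice e'], which is H' and contains every
   [slice e m] composed with g. At vertex 2 the transpose of g is used. *)
pose f1 := ((slice e')^-1 \o pre \o slice e)%VF.
have f1E m : slice e' (f1 m) = (slice e m \o g)%VF.
  rewrite !comp_lfunE limg_lfunVK ?preE //.
  by apply/hg; exists (slice e m); rewrite // memv_img ?memvf.
pose B := (lin1_mx g)^T.
pose f2 : 'Hom(rep2 M, rep2 M') := (e'^-1 \o linfun (mulmxr B) \o e)%VF.
have f2E v : e' (f2 v) = e v *m B.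
  by rewrite !comp_lfunE limg_lfunVK ?se' ?memvf // lfunE.
have dotB w u : dot w (u *m B) = dot (g w) u.
  by rewrite dot_mulmx trmxK mulmx_lin1.
have com j : (f2 \o gam M j = gam M' j \o f1)%VF.
  apply/lfunP => m; rewrite comp_lfunE [RHS]comp_lfunE.
  have /lker0P injE : lker e' == 0%VS by rewrite e'0.
  apply: injE; apply: dot_inj => w; rewrite f2E dotB.
  have fw : slice e' (f1 m) w = slice e m (g w) by rewrite f1E comp_lfunE.
  by move/rowP/(_ j): fw; rewrite !sliceE !mxE.
apply: (@khom_rep_iso _ _ _ _ (KHom com)); rewrite ?dM ?dM' //; split=> /=.
  apply: lker0I => m f1m; apply: (lker_inj (slice_lker0 y0 se gM)).
  apply/lfunP => w; have [u ->] := limg_surj w sg.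
  by rewrite -comp_lfunE -f1E f1m linear0 !zero_lfunE.
apply: lker0I => v f2v; apply: (lker_inj e0); apply: dot_eq0 => w.
have [u ->] := limg_surj w sg.
by rewrite dotC -dotB -f2E f2v linear0 /dot trmx0 mulmx0 mxE.
Qed.

Lemma exists_coordinates (V : vectType k) : \dim {: V} = y ->
  exists e : 'Hom(V, 'rV[k]_y), lker e = 0%VS.
Proof.
move=> <-; exists (linfun (fun v => \row_i coord (vbasis {: V}) i v)).
apply: lker0I => v; rewrite linfunE => [/rowP h|c u w]; last first.
  by apply/rowP => i; rewrite !mxE linearP.
rewrite (coord_vbasis (memvf v)) big1 // => i _.
by have := h i; rewrite !mxE => ->; rewrite scale0r.
Qed.

(** The same tensor read backwards: with the identity as coordinates, the slice of h is h itself. *)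
Definition subspace_rep H : krep k r :=
  @KRep k r (subvs_of H) 'rV[k]_y
    (fun j => linfun (fun h : subvs_of H => \row_i vsval h (delta_mx 0 i) 0 j)).

Lemma slice_subspace_rep H (h : subvs_of H) :
  slice (M := subspace_rep H) \1%VF h = vsval h.
Proof.
apply/lfunP => w; rewrite sliceE; apply/rowP => j; rewrite mxE id_lfunE.
rewrite linfunE => [|c u v]; last first.
  by apply/rowP => i; rewrite !mxE linearP add_lfunE scale_lfunE !mxE.
rewrite /dot mxE [in RHS](row_sum_delta w) linear_sum summxE.
by apply: eq_bigr => i _; rewrite linearZ !mxE.
Qed.

Lemma subspace_rep_corresponds H : corresponds (subspace_rep H) H.
Proof.
exists \1%VF; first by apply: lker0I => u; rewrite id_lfunE.
apply/vspaceP => v; apply/idP/memv_imgP => [vH|[h _ ->]].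
  by exists (vsproj H v); rewrite ?memvf // slice_subspace_rep vsprojK.
by rewrite slice_subspace_rep subvsP.
Qed.

Lemma subspace_rep_generated H : rank_property H -> generated (subspace_rep H).
Proof.
move=> rH; apply: (@generated_slice k y r (subspace_rep H) \1%VF).
- by apply: lker0I => u; rewrite id_lfunE.
- exact: dim_rV.
move=> h h0; apply/eqP; rewrite -lker_lin_rank slice_subspace_rep; apply/eqP/rH.
  exact: subvsP.
by apply: contra h0 => /eqP h0; apply/eqP/val_inj.
Qed.

Lemma generated_rank_property M H : d2 M = y -> generated M ->
  corresponds M H -> rank_property H.
Proof.
move=> dM gM [e e0 ->] _ /memv_imgP[m _ ->] sm0; apply/eqP; rewrite lker_lin_rank.
have se : limg e = fullv by apply: lker0_limg; rewrite // dim_rV.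
by rewrite (slice_generated se gM) //; apply: contra sm0 => /eqP ->; rewrite linear0.
Qed.

Lemma corresponds_dim M H : (0 < y)%N -> d2 M = y -> generated M ->
  corresponds M H -> \dim H = d1 M.
Proof.
move=> y0 dM gM [e e0 ->].
have se : limg e = fullv by apply: lker0_limg; rewrite // dim_rV.
by rewrite limg_dim_eq // slice_lker0 ?capv0.
Qed.

End Correspondence.

(** * Polynomial multiplication attains the bound *)

Section Toeplitz.
Local Open Scope ring_scope.
Variables (k : fieldType) (x y : nat).

Definition toeplitz (p : 'rV[k]_x) : lin_maps k y (x + y - 1) :=
  linfun (fun w : 'rV[k]_y => poly_rV (rVpoly p * rVpoly w) : 'rV_(x + y - 1)).

Lemma toeplitzE p w : toeplitz p w = poly_rV (rVpoly p * rVpoly w).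
Proof. by rewrite linfunE // => c u v; rewrite linearP mulrDr -scalerAr linearP. Qed.

(** The product has size at most x + y - 1, so [poly_rV] truncates nothing, and k[t] is a domain. *)
Lemma toeplitz_eq0 p w : toeplitz p w = 0 -> p = 0 \/ w = 0.
Proof.
rewrite toeplitzE => /(congr1 rVpoly); rewrite poly_rV_K; last first.
  apply: leq_trans (size_polyMleq _ _) _; rewrite -subn1 leq_sub2r //.
  by rewrite leq_add // size_poly.
rewrite linear0 => /eqP; rewrite mulf_eq0 => /orP[]/eqP h; [left|right].
  by rewrite -[p]rVpolyK h linear0.
by rewrite -[w]rVpolyK h linear0.
Qed.

Lemma rank_property_exists : (0 < y)%N ->
  exists2 H : {vspace lin_maps k y (x + y - 1)}, rank_property H & \dim H = x.
Proof.
move=> y0; have tL : linear toeplitz.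
  move=> c p q; apply/lfunP => w; rewrite add_lfunE scale_lfunE !toeplitzE.
  by rewrite linearP mulrDl -scalerAl linearP.
exists (limg (linfun toeplitz)).
  move=> _ /memv_imgP[p _ ->]; rewrite linfunE // => p0.
  apply/eqP; rewrite lker_lin_rank; apply/eqP/lker0I => w /toeplitz_eq0[p00|//].
  by rewrite p00 -(linfunE tL) linear0 eqxx in p0.
rewrite limg_dim_eq ?dim_rV //; apply/eqP; rewrite -subv0; apply/subvP => p.
rewrite memv_cap memv_ker linfunE // => /andP[_ /eqP tp0]; rewrite memv0.
have /toeplitz_eq0[->//|/rowP/(_ (Ordinal y0))] : toeplitz p (const_mx 1) = 0.
  by rewrite tp0 zero_lfunE.
by rewrite !mxE => /eqP; rewrite oner_eq0.
Qed.

End Toeplitz.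

Theorem theorem1p1 (k : closedFieldType) (n x y : nat)
    (hn : (3 <= n)%N) (hF : setF n x y) (hx : (x < n)%N) (hy : (1 < y)%N) :
  exists Phi : classes (@rep_iso k (x + y - 1)) (@setM k x y) ->
               classes (@subspace_iso k y (x + y - 1)) (@setL k x y),
    bijective Phi.
Proof.
have [_ y0 _ yx] := hF.
(* From 2 <= y <= x: both dimensions are at most r - 1, as the regularity criterion demands. *)
have r3 : 3 <= x + y - 1 by lia.
have xr : x <= (x + y - 1).-1 by lia.
have yr : y <= (x + y - 1).-1 by lia.
have xE : (x + y - 1).+1 - y = x by lia.
have gen M : @setM k x y M -> [/\ generated M, d1 M = x & d2 M = y].
  move=> [eM [e1 e2]]; split; [|exact: e1|exact: e2].
  by apply: elementary_generated; rewrite ?/d1 ?e1 ?/d2 ?e2.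
(* Being maximum amounts to having dimension x: the bilinear zero bound gives at most r + 1 - y = x,
   and Toeplitz matrices attain it. *)
have setLP H : @setL k x y H <-> rank_property H /\ \dim H = x.
  have dimH H' := @rank_property_dim k y (x + y - 1) H' y0; rewrite xE in dimH.
  split=> [[rH maxH]|[rH dH]]; split=> //; last by move=> H' rH'; rewrite dH dimH.
  have [H' rH' dH'] := rank_property_exists k x y0.
  by apply/eqP; rewrite eqn_leq dimH //= -{1}dH' maxH.
apply: (@classes_bijection _ _ _ _ _ _ (@corresponds k y (x + y - 1))).
- exact: rep_iso_refl.
- exact: rep_iso_trans.
- exact: subspace_iso_refl.
- exact: subspace_iso_trans.
- move=> M /gen[gM e1 e2]; have [e e0] := exists_coordinates e2.
  have cM : corresponds M (limg (slice e)) by exists e.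
  exists (limg (slice e)) => //; apply/setLP; split.
    exact: generated_rank_property cM.
  by rewrite (corresponds_dim _ _ _ cM).
- move=> H /setLP[rH dH]; exists (subspace_rep H); last exact: subspace_rep_corresponds.
  have e1 : d1 (subspace_rep H) = x by rewrite /d1 dim_subvs.
  have e2 : d2 (subspace_rep H) = y by rewrite /d2 dim_rV.
  split; last by split.
  apply: generated_elementary; rewrite ?e1 ?e2 //; first by lia.
    by lia.
  exact: subspace_rep_generated.
move=> M M' H H' /gen[gM e1 e2] /gen[gM' e1' e2'] _ _ cM cM'; split.
  exact: corresponds_rep_iso cM cM'.
by apply: corresponds_subspace_iso cM cM'; rewrite ?e1 ?e1' //; lia.
Qed.
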